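(* Let $G$ be a connected $2n$-dimensional Lie group equipped with a left invariant complex structure $J$, and let $\sigma$ denote a nonzero left invariant $(n,0)$-form on $G$. Assume that $\tau_1:=f_1\sigma$ is closed, for some smooth function $f_1:G\to\mathbb{C}^\times$. If $f_2:G\to\mathbb{C}^\times$ is another smooth function on $G$, then $\tau_2:=f_2\sigma$ is closed if and only if $\frac{f_2}{f_1}$ is a holomorphic function on $(G,J)$. In particular, if $G$ is compact and $\tau_2$ is closed, then $f_2=cf_1$ for some $c\in\mathbb{C}^\times$.
   Context: $\mathbb{C}^\times=\mathbb{C}\setminus\{0\}$. A left invariant complex structure on $G$ is a complex structure for which left translations are holomorphic maps. *)

(* Defs.v *)
From HB Require Import structures.
From mathcomp Require Import all_boot all_order all_algebra.
From mathcomp Require Import all_classical all_reals all_analysis.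
From mathcomp Require Import complex.
Import Order.TTheory GRing.Theory Num.Theory.
Import numFieldNormedType.Exports.

Set Implicit Arguments.
Unset Strict Implicit.
Unset Printing Implicit Defensive.

Local Open Scope classical_set_scope.
Local Open Scope ring_scope.

(* C^k on an open set U of a finite-dimensional space: the directional
   derivatives up to order k exist and are continuous on U. *)
Fixpoint Ck_on (R : realType) (V W : normedModType R) (k : nat)
    (U : set V) (f : V -> W) : Prop :=
  (forall x, U x -> {for x, continuous f}) /\
  (if k is k'.+1 then
     forall v : V, (forall x, U x -> derivable f x v) /\
                   Ck_on k' U (fun x => 'D_v f x)
   else True).

Definition smooth_on (R : realType) (V W : normedModType R)
    (U : set V) (f : V -> W) : Prop := forall k, Ck_on k U f.

(* A homeomorphism between an open subset cdom of M and an open subset ccod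
   of R^m.  Both directions are total functions, meaningful on cdom and ccod
   respectively. *)
Record coord_chart (R : realType) (m : nat) (M : topologicalType) := CoordChart {
  cdom : set M;
  ccod : set 'rV[R]_m;
  cfun :> M -> 'rV[R]_m;
  cinv : 'rV[R]_m -> M;
  cdom_open : open cdom;
  ccod_open : open ccod;
  cfun_cod : forall p, cdom p -> ccod (cfun p);
  cinv_dom : forall x, ccod x -> cdom (cinv x);
  cfunK : forall p, cdom p -> cinv (cfun p) = p;
  cinvK : forall x, ccod x -> cfun (cinv x) = x;
  cfun_continuous : forall p, cdom p -> {for p, continuous cfun};
  cinv_continuous : forall x, ccod x -> {for x, continuous cinv}
}.

(* m-dimensional smooth manifolds, given by a smooth atlas, which is indexed
   by chart_ix and need not be maximal. *)
HB.mixin Record isSmoothManifold (R : realType) (m : nat) M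
    of Topological M := {
  chart_ix : Type;
  chart : chart_ix -> coord_chart R m M;
  manifold_hausdorff : hausdorff_space M;
  manifold_second_countable : @second_countable M;
  chart_cover : forall p : M, exists c, cdom (chart c) p;
  chart_compat : forall c d : chart_ix,
    smooth_on (ccod (chart c) `&` cinv (chart c) @^-1` cdom (chart d))
              (chart d \o cinv (chart c))
}.

#[short(type="smoothManifoldType")]
HB.structure Definition SmoothManifold (R : realType) (m : nat) :=
  { M of Topological M & isSmoothManifold R m M }.

Arguments chart_ix {R m} s.
Arguments chart {R m s} c.

Section SmoothMaps.
Context (R : realType) (m k : nat).
Context (M : smoothManifoldType R m) (N : smoothManifoldType R k).

(* The coordinate representative of f in the charts c and d, and the open set
   on which it is defined. *)
Definition lrep (f : M -> N) (c : chart_ix M) (d : chart_ix N) :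
    'rV[R]_m -> 'rV[R]_k :=
  fun x => chart d (f (cinv (chart c) x)).

Definition ldom (f : M -> N) (c : chart_ix M) (d : chart_ix N) :
    set 'rV[R]_m :=
  [set x | ccod (chart c) x /\ cdom (chart d) (f (cinv (chart c) x))].

Definition smooth_map (f : M -> N) : Prop :=
  continuous f /\ forall c d, smooth_on (ldom f c d) (lrep f c d).

End SmoothMaps.

HB.mixin Record isLieGroup (R : realType) (m : nat) G
    of SmoothManifold R m G & Group G := {
  mulg_continuous : continuous (fun p : G * G => (p.1 * p.2)%g);
  mulg_smooth : forall a b c : chart_ix (G : smoothManifoldType R m),
    smooth_on
      [set p : 'rV[R]_m * 'rV[R]_m |
        [/\ ccod (chart a) p.1, ccod (chart b) p.2 &
            cdom (chart c) (cinv (chart a) p.1 * cinv (chart b) p.2)%g]]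
      (fun p => chart c (cinv (chart a) p.1 * cinv (chart b) p.2)%g);
  invg_smooth :
    smooth_map (fun g : (G : smoothManifoldType R m) =>
                  (g^-1)%g : (G : smoothManifoldType R m))
}.

#[short(type="lieGroupType")]
HB.structure Definition LieGroup (R : realType) (m : nat) :=
  { G of SmoothManifold R m G & Group G & isLieGroup R m G }.

Section ComplexFunctions.
Context (R : realType) (V : normedModType R).

Definition csmooth_on (U : set V) (f : V -> R[i]) : Prop :=
  smooth_on U (fun x => complex.Re (f x) : R^o) /\
  smooth_on U (fun x => complex.Im (f x) : R^o).

(* Derivative of a complex-valued function along the real vector v. *)
Definition cderive (v : V) (f : V -> R[i]) (x : V) : R[i] :=
  Complex ('D_v (fun y => complex.Re (f y) : R^o) x)
          ('D_v (fun y => complex.Im (f y) : R^o) x).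

End ComplexFunctions.

Definition smooth_cfun (R : realType) (m : nat) (M : smoothManifoldType R m)
    (f : M -> R[i]) : Prop :=
  forall c : chart_ix M, csmooth_on (ccod (chart c)) (f \o cinv (chart c)).

(* Tensor fields are families of coordinate representatives, one for each
   chart, subject to the transformation law between charts; only the values on
   ccod (chart c) are meaningful.  Tangent vectors are row vectors, so an
   endomorphism of the tangent space acts by v |-> v *m J, and a k-tuple of
   tangent vectors is a k x m matrix. *)

Section AlmostComplex.
Context (R : realType).

Definition endo_field (m : nat) (M : smoothManifoldType R m) : Type :=
  chart_ix M -> 'rV[R]_m -> 'M[R]_m.

(* df \o JM = JN \o df *)
Definition intertwines (m k : nat) (M : smoothManifoldType R m)
    (N : smoothManifoldType R k) (JM : endo_field M) (JN : endo_field N)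
    (f : M -> N) : Prop :=
  forall c d x, ldom f c d x -> forall v : 'rV[R]_m,
    'D_(v *m JM c x) (lrep f c d) x =
    'D_v (lrep f c d) x *m JN d (lrep f c d x).

Definition lie_bracket (m : nat) (X Y : 'rV[R]_m -> 'rV[R]_m) :
    'rV[R]_m -> 'rV[R]_m :=
  fun x => 'D_(X x) Y x - 'D_(Y x) X x.

Definition nijenhuis (m : nat) (J : 'rV[R]_m -> 'M[R]_m)
    (X Y : 'rV[R]_m -> 'rV[R]_m) : 'rV[R]_m -> 'rV[R]_m :=
  let JX := fun x => X x *m J x in
  let JY := fun x => Y x *m J x in
  fun x => lie_bracket JX JY x - lie_bracket JX Y x *m J x
           - lie_bracket X JY x *m J x - lie_bracket X Y x.

(* Taking f = id in intertwines gives the transformation law of J. *)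
Record complex_structure (m : nat) (M : smoothManifoldType R m)
    (J : endo_field M) : Prop := ComplexStructure {
  cs_compat : intertwines J J (@id M);
  cs_smooth : forall c, smooth_on (ccod (chart c)) (J c);
  cs_square : forall c x, ccod (chart c) x -> J c x *m J c x = - 1%:M;
  cs_integrable : forall c X Y,
    smooth_on (ccod (chart c)) X -> smooth_on (ccod (chart c)) Y ->
    forall x, ccod (chart c) x -> nijenhuis (J c) X Y x = 0
}.

Definition holomorphic_map (m k : nat) (M : smoothManifoldType R m)
    (N : smoothManifoldType R k) (JM : endo_field M) (JN : endo_field N)
    (f : M -> N) : Prop :=
  smooth_map f /\ intertwines JM JN f.

(* df(J v) = 'i df(v) *)
Definition holomorphic_fun (m : nat) (M : smoothManifoldType R m)
    (J : endo_field M) (f : M -> R[i]) : Prop :=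
  smooth_cfun f /\
  forall c x, ccod (chart c) x -> forall v : 'rV[R]_m,
    cderive (v *m J c x) (f \o cinv (chart c)) x =
    'i%C * cderive v (f \o cinv (chart c)) x.

Definition left_invariant_cs (m : nat) (G : lieGroupType R m)
    (J : endo_field G) : Prop :=
  complex_structure J /\
  forall g : G, holomorphic_map J J (fun p : G => (g * p)%g : G).

End AlmostComplex.

Section Forms.
Context (R : realType) (m : nat).

Definition cform_family (k : nat) (M : smoothManifoldType R m) : Type :=
  chart_ix M -> 'rV[R]_m -> 'M[R]_(k, m) -> R[i].

(* Same formulation as determinant_multilinear, for real scalars. *)
Definition multilinear_rows (k : nat) (w : 'M[R]_(k, m) -> R[i]) : Prop :=
  forall (A B C : 'M[R]_(k, m)) (i : 'I_k) (b c : R),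
    row i A = b *: row i B + c *: row i C ->
    row' i B = row' i A -> row' i C = row' i A ->
    w A = b%:C%C * w B + c%:C%C * w C.

Definition alternating_rows (k : nat) (w : 'M[R]_(k, m) -> R[i]) : Prop :=
  forall (A : 'M[R]_(k, m)) (i j : 'I_k),
    i != j -> row i A = row j A -> w A = 0.

(* f^* w = w *)
Definition pullback_fixes (k : nat) (M : smoothManifoldType R m)
    (w : cform_family k M) (f : M -> M) : Prop :=
  forall c d x, ldom f c d x -> forall A : 'M[R]_(k, m),
    w d (lrep f c d x) (\matrix_(i < k) 'D_(row i A) (lrep f c d) x) =
    w c x A.

(* Smooth complex-valued k-forms; taking f = id in pullback_fixes gives the
   transformation law between charts. *)
Record is_cform (k : nat) (M : smoothManifoldType R m)
    (w : cform_family k M) : Prop := IsCform {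
  cform_compat : pullback_fixes w id;
  cform_multilinear : forall c x, ccod (chart c) x -> multilinear_rows (w c x);
  cform_alternating : forall c x, ccod (chart c) x -> alternating_rows (w c x);
  cform_smooth : forall c (A : 'M[R]_(k, m)),
    csmooth_on (ccod (chart c)) (fun x => w c x A)
}.

(* Bidegree (k, 0): the complex-multilinear extension of w vanishes as soon as
   one argument is of type (0,1), i.e. of the form X + 'i J X. *)
Definition bidegree_k0 (k : nat) (M : smoothManifoldType R m)
    (J : endo_field M) (w : cform_family k M) : Prop :=
  forall c x, ccod (chart c) x -> forall (i : 'I_k) (A B : 'M[R]_(k, m)),
    row i B = row i A *m J c x -> row' i B = row' i A ->
    w c x A + 'i%C * w c x B = 0.

Definition left_invariant_form (k : nat) (G : lieGroupType R m)
    (w : cform_family k G) : Prop :=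
  forall g : G, pullback_fixes w (fun p : G => (g * p)%g : G).

Definition nonzero_form (k : nat) (M : smoothManifoldType R m)
    (w : cform_family k M) : Prop :=
  exists c x A, ccod (chart c) x /\ w c x A != 0.

Definition scale_form (k : nat) (M : smoothManifoldType R m)
    (f : M -> R[i]) (w : cform_family k M) : cform_family k M :=
  fun c x A => f (cinv (chart c) x) * w c x A.

(* Exterior derivative in coordinates, evaluated on constant vector fields
   (whose brackets vanish):
   (dw)_x(v_0, .., v_k) = \sum_i (-1)^i D_{v_i} (w(v_0, .., ^v_i, .., v_k)). *)
Definition ext_derivative (k : nat) (M : smoothManifoldType R m)
    (w : cform_family k M) : cform_family k.+1 M :=
  fun c x A =>
    \sum_(i < k.+1) (-1) ^+ i * cderive (row i A) (fun y => w c y (row' i A)) x.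

Definition closed_form (k : nat) (M : smoothManifoldType R m)
    (w : cform_family k M) : Prop :=
  forall c x, ccod (chart c) x -> forall A, ext_derivative w c x A = 0.

End Forms.

(* Main.v *)
Require Import Defs.
From HB Require Import structures.
From mathcomp Require Import all_boot all_order all_algebra.
From mathcomp Require Import fingroup perm.
From mathcomp Require Import all_classical all_reals all_analysis.
From mathcomp Require Import complex.
From mathcomp Require Import ring.
Import Order.TTheory GRing.Theory Num.Theory.
Import numFieldNormedType.Exports.

Set Implicit Arguments.
Unset Strict Implicit.
Unset Printing Implicit Defensive.

Local Open Scope classical_set_scope.
Local Open Scope ring_scope.

(* Put q = f2 / f1, so that d(f2 sigma) = dq /\ (f1 sigma) and f1 sigma is
   nowhere zero.  Pointwise, dq /\ (f1 sigma) = 0 iff dq is J-linear: feeding the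
   vectors X + 'i J X, e_1, .., e_n to the wedge product isolates
   (dq(X) + 'i dq(JX)) sigma(e_1, .., e_n); conversely n + 1 vectors are dependent
   over the complex numbers, and an alternating J-multilinear form in n + 1
   variables vanishes on them.
   Suppose now that G is compact and that dq is not identically zero.  Finitely
   many left translations L_a_i are such that every point is sent by one of them
   to a point where dq is nonzero.  At a maximum of \sum_i |q \o L_a_i|^2, apply
   D_v D_v + D_Jv D_Jv, corrected by the first-order operator coming from the
   variation of J: this kills the second derivatives of the holomorphic functions
   q \o L_a_i and leaves a positive multiple of \sum_i |D_v (q \o L_a_i)|^2, which
   is therefore <= 0.  Hence all d(q \o L_a_i) vanish there, a contradiction. *)

(** * Wedge product of a 1-form with an alternating form *)

(** Turns multilinearity into ordinary linearity in one row, the other rows being frozen. *)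
Definition setrow (R : realType) (n m : nat) (k : 'I_n) (v : 'rV[R]_m)
    (E : 'M[R]_(n, m)) : 'M[R]_(n, m) :=
  \matrix_(i, j) if i == k then v 0 j else E i j.

Lemma row_setrow (R : realType) (n m : nat) (i k : 'I_n) (v : 'rV[R]_m)
  (E : 'M[R]_(n, m)) :
  row i (setrow k v E) = if i == k then v else row i E.
Proof. by apply/rowP => j; rewrite !mxE; case: ifP; rewrite ?mxE. Qed.

Lemma row'_setrow (R : realType) (n m : nat) (k : 'I_n) (v : 'rV[R]_m)
  (E : 'M[R]_(n, m)) :
  row' k (setrow k v E) = row' k E.
Proof. by apply/matrixP => i j; rewrite !mxE eq_sym (negbTE (neq_lift _ _)). Qed.

Lemma row'_setrow_lift (R : realType) (n m : nat) (i : 'I_n.+1) (k : 'I_n)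
  (v : 'rV[R]_m) (E : 'M[R]_(n.+1, m)) :
  row' i (setrow (lift i k) v E) = setrow k v (row' i E).
Proof.
by apply/matrixP => a j; rewrite !mxE (inj_eq lift_inj).
Qed.

Lemma setrow_id (R : realType) (n m : nat) (k : 'I_n) (E : 'M[R]_(n, m)) :
  setrow k (row k E) E = E.
Proof. by apply/matrixP => i j; rewrite !mxE; case: eqP => // ->. Qed.

Lemma multilinear_setrow (R : realType) (n m : nat) (w : 'M[R]_(n, m) -> R[i])
  (k : 'I_n) (a b : R) (u v : 'rV[R]_m) (E : 'M[R]_(n, m)) :
  multilinear_rows w ->
  w (setrow k (a *: u + b *: v) E) =
  a%:C%C * w (setrow k u E) + b%:C%C * w (setrow k v E).
Proof.
move=> wm; apply: (wm _ _ _ k); rewrite ?row'_setrow//.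
by rewrite !row_setrow eqxx.
Qed.

(** Polarisation: put [row i E + row j E] in both slots and expand. The value is 0, the two diagonal
    terms vanish, and the two cross terms are [w] at [E] and at the swapped matrix. *)
Lemma alternating_tperm (R : realType) (n m : nat) (w : 'M[R]_(n, m) -> R[i])
  (E : 'M[R]_(n, m)) (i j : 'I_n) :
  multilinear_rows w -> alternating_rows w -> i != j ->
  w (row_perm (tperm i j) E) = - w E.
Proof.
move=> wm wa ij.
pose F u v := w (setrow i u (setrow j v E)).
have Fuu u : F u u = 0.
  apply: (wa _ i j) => //.
  by rewrite !row_setrow !eqxx eq_sym (negbTE ij).
have swap u v : setrow i u (setrow j v E) = setrow j v (setrow i u E).
  apply/matrixP => a b; rewrite !mxE.
  by case: eqP => // ->; rewrite (negbTE ij).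
have FDl u u' v : F (u + u') v = F u v + F u' v.
  have := multilinear_setrow i 1 1 u u' (setrow j v E) wm.
  by rewrite !scale1r !mul1r.
have FDr u v v' : F u (v + v') = F u v + F u v'.
  rewrite /F !swap.
  have := multilinear_setrow j 1 1 v v' (setrow i u E) wm.
  by rewrite !scale1r !mul1r.
have := Fuu (row i E + row j E).
rewrite FDl !FDr !Fuu addr0 add0r => /eqP; rewrite addrC addr_eq0 => /eqP.
rewrite /F setrow_id setrow_id => <-; congr w.
apply/matrixP => a b; rewrite !mxE.
case: tpermP => [->|->|/eqP/negbTE-> /eqP/negbTE->] //; first by rewrite eqxx.
by rewrite eq_sym (negbTE ij) eqxx.
Qed.

Lemma alternating_row_perm (R : realType) (n m : nat) (w : 'M[R]_(n, m) -> R[i])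
  (s : 'S_n) (E : 'M[R]_(n, m)) :
  multilinear_rows w -> alternating_rows w ->
  w (row_perm s E) = (-1) ^+ s * w E.
Proof.
move=> wm wa; have [ts -> dts] := prod_tpermP s.
elim: ts dts E => [|t ts IH] /= => [_|/andP[tP /IH {}IH]] E.
  by rewrite big_nil row_perm1 odd_perm1 mul1r.
rewrite big_cons row_permM alternating_tperm// IH odd_mul_tperm tP.
by rewrite signr_addb expr1 mulN1r mulNr.
Qed.

(** The product a /\ w without factorial normalisation. The signs match those of [ext_derivative],
    so that d(q w) = dq /\ w + q dw holds with no extra constants. *)
Definition wedge1 (R : realType) (n m : nat) (a : 'rV[R]_m -> R[i])
    (w : 'M[R]_(n, m) -> R[i]) (E : 'M[R]_(n.+1, m)) : R[i] :=
  \sum_(i < n.+1) (-1) ^+ i * (a (row i E) * w (row' i E)).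

(* When rows i and j of E agree, the terms of index i and j cancel: deleting row i
   or row j gives the same rows up to the permutation s with
   lift_perm i j s = tperm i j. *)
Lemma wedge1_alternating (R : realType) (n m : nat) (a : 'rV[R]_m -> R[i])
  (w : 'M[R]_(n, m) -> R[i]) :
  multilinear_rows w -> alternating_rows w ->
  alternating_rows (wedge1 a w).
Proof.
move=> wm wa E i j ij Eij.
rewrite /wedge1 (bigD1 i)//= (bigD1 j) /=; last by rewrite eq_sym.
rewrite big1 ?addr0; last first.
  move=> k /andP[ki kj].
  have [i' ei|] := unliftP k i; last by move=> e; rewrite e eqxx in ki.
  have [j' ej|] := unliftP k j; last by move=> e; rewrite e eqxx in kj.
  rewrite (wa _ i' j') ?mulr0//; last first.
    rewrite [LHS](_ : _ = row i E); last by apply/rowP => b; rewrite !mxE -ei.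
    by rewrite Eij; apply/rowP => b; rewrite !mxE -ej.
  by apply: contraNneq ij => e; rewrite ei ej e.
have unl k : exists l, tperm i j (lift i k) = lift j l.
  have [l el|] := unliftP j (tperm i j (lift i k)); first by exists l.
  move/eqP; rewrite -{2}(tpermL i j) (inj_eq perm_inj) eq_sym.
  by rewrite (negbTE (neq_lift _ _)).
pose f k := projT1 (cid (unl k)).
have fP k : tperm i j (lift i k) = lift j (f k) by rewrite /f; case: cid.
have f_inj : injective f.
  move=> k l e; apply: (@lift_inj _ i); apply: (@perm_inj _ (tperm i j)).
  by rewrite !fP e.
pose s := perm f_inj.
have tE : tperm i j = lift_perm i j s.
  apply/permP => k; have [k' ->|->] := unliftP i k.
    by rewrite fP lift_perm_lift permE.
  by rewrite tpermL lift_perm_id.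
have rE : row' i E = row_perm s (row' j E).
  apply/matrixP => k b; rewrite !mxE permE -fP.
  case: tpermP => // [e|->]; first by have := neq_lift i k; rewrite e eqxx.
  by have /rowP/(_ b) := Eij; rewrite !mxE => <-; congr (E _ b).
rewrite rE alternating_row_perm// Eij.
(* A transposition is odd, so i, j and the parity of [s] add up to an odd number: the two surviving
   terms have opposite signs. *)
have := odd_lift_perm i j s; rewrite -tE odd_tperm ij => /esym os.
have -> : (-1) ^+ i = (-1) ^+ j * - (-1) ^+ s :> R[i].
  rewrite mulrN -signr_odd -(signr_odd _ j) -signr_addb.
  move: os; case: (odd i); case: (odd j); case: (odd_perm s) => //= _;
  by rewrite ?expr0 ?expr1 ?opprK.
have ss : (-1) ^+ s * (-1) ^+ s = 1 :> R[i] by rewrite -signr_addb addbb.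
set x := (-1) ^+ j; set y := (-1) ^+ s in ss *; set c := a _; set d := w _.
transitivity (x * (c * d) * (1 - y * y)); first by ring.
by rewrite ss subrr mulr0.
Qed.

(** * Wedge products with forms of type (n,0) *)

Section WedgeJ.
Context (R : realType) (n m : nat) (J : 'M[R]_m) (w : 'M[R]_(n, m) -> R[i]).
Context (wm : multilinear_rows w) (wa : alternating_rows w).
Hypothesis wJ : forall (i : 'I_n) (A B : 'M[R]_(n, m)),
    row i B = row i A *m J -> row' i B = row' i A ->
    w A + 'i%C * w B = 0.

(** Working form of the bidegree condition: each argument is complex linear, with J acting as
    multiplication by 'i. *)
Lemma bidegree_setrow (k : 'I_n) (v : 'rV[R]_m) (E : 'M[R]_(n, m)) :
  w (setrow k (v *m J) E) = 'i%C * w (setrow k v E).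
Proof.
have := @wJ k (setrow k v E) (setrow k (v *m J) E).
rewrite !row_setrow !row'_setrow !eqxx => /(_ erefl erefl)/eqP.
rewrite addr_eq0 => /eqP ->; rewrite mulrN mulrA -expr2 sqr_i mulN1r opprK //.
Qed.

Lemma wedge1_eq0_Jlinear (a : 'rV[R]_m -> R[i]) (E : 'M[R]_(n, m)) :
  w E != 0 -> (forall A, wedge1 a w A = 0) ->
  forall v, a (v *m J) = 'i%C * a v.
Proof.
move=> wE aw0 v.
pose A (u : 'rV[R]_m) : 'M[R]_(n.+1, m) :=
  \matrix_(i, j) if unlift ord0 i is Some i' then E i' j else u 0 j.
have rA0 u : row 0 (A u) = u by apply/rowP => j; rewrite !mxE unlift_none.
have rAS u i : row (lift ord0 i) (A u) = row i E.
  by apply/rowP => j; rewrite !mxE liftK.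
have r'A0 u : row' 0 (A u) = E by apply/matrixP => i j; rewrite !mxE liftK.
have r'AS i : exists k F, forall u, row' (lift ord0 i) (A u) = setrow k u F.
  (* [k] is the index 0, available because [i] inhabits ['I_n]. Deleting a row of [E] leaves [u] on
     top. *)
  pose k : 'I_n := Ordinal (leq_ltn_trans (leq0n i) (ltn_ord i)).
  have kE (x : 'I_n) : (lift (lift ord0 i) x == ord0) = (x == k).
    rewrite -!val_eqE /= /bump /= add1n; case: (val x) => //= x'.
    by rewrite addn_eq0 andbF.
  exists k, (row' (lift ord0 i) (A 0)) => u'.
  apply/matrixP => x y; rewrite !mxE -kE.
  by case: unliftP => [x' ->|->]; rewrite ?eqxx// eq_sym (negbTE (neq_lift _ _)).
(* This combination is the complex-multilinear extension evaluated at v + 'i Jv on top of [E]. The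
   terms that keep this vector inside [w] cancel, as 1 + 'i ^ 2 = 0, and only the term of index 0
   remains. *)
have := congr2 (fun x y => x + 'i%C * y) (aw0 (A v)) (aw0 (A (v *m J))).
rewrite mulr0 addr0 /wedge1 mulr_sumr -big_split big_ord_recl big1 ?addr0 /=.
  rewrite !rA0 !r'A0 !expr0 !mul1r => e.
  have /eqP : (a v + 'i%C * a (v *m J)) * w E = 0 by rewrite -e; ring.
  rewrite mulf_eq0 (negbTE wE) orbF addr_eq0 => /eqP ->.
  by rewrite mulrN mulrA -expr2 sqr_i mulN1r opprK.
move=> i _; have [k [F FE]] := r'AS i.
rewrite !FE bidegree_setrow !rAS.
set c := _ ^+ _; set x := a _; set y := w _.
transitivity (c * x * y * (1 + 'i%C ^+ 2)); first by ring.
by rewrite sqr_i subrr mulr0.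
Qed.

Lemma Jlinear_wedge1_eq0 (a : 'rV[R]_m -> R[i]) : (m < (n.+1).*2)%N ->
  (forall (b c : R) u v, a (b *: u + c *: v) = b%:C%C * a u + c%:C%C * a v) ->
  (forall v, a (v *m J) = 'i%C * a v) ->
  forall A, wedge1 a w A = 0.
Proof.
move=> mn alin aJ A.
pose T k v := wedge1 a w (setrow k v A).
have Tlin k (b c : R) u v : T k (b *: u + c *: v) = b%:C%C * T k u + c%:C%C * T k v.
  rewrite /T /wedge1 !mulr_sumr -big_split; apply: eq_bigr => i _ /=.
  rewrite !row_setrow; have [->|ik] := eqVneq i k.
    by rewrite alin !row'_setrow; ring.
  have [k' ->|e] := unliftP i k; last by rewrite e eqxx in ik.
  by rewrite !row'_setrow_lift multilinear_setrow//; ring.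
have TJ k v : T k (v *m J) = 'i%C * T k v.
  rewrite /T /wedge1 mulr_sumr; apply: eq_bigr => i _ /=.
  rewrite !row_setrow; have [->|ik] := eqVneq i k.
    by rewrite aJ !row'_setrow; ring.
  have [k' ->|e] := unliftP i k; last by rewrite e eqxx in ik.
  by rewrite !row'_setrow_lift bidegree_setrow//; ring.
have T0 k : T k 0 = 0.
  by have := Tlin k 0 0 0 0; rewrite scale0r addr0 !mul0r addr0.
have TD k u v : T k (u + v) = T k u + T k v.
  by have := Tlin k 1 1 u v; rewrite !scale1r !mul1r.
have TZ k b u : T k (b *: u) = b%:C%C * T k u.
  by have := Tlin k b 0 u 0; rewrite scale0r addr0 mul0r addr0.
have Talt k l : l != k -> T k (row l A) = 0.
  move=> lk; apply: (wedge1_alternating a wm wa (i := k) (j := l)).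
    by rewrite eq_sym.
  by rewrite !row_setrow eqxx (negbTE lk).
(* The 2(n + 1) rows of [A] and [A *m J] live in dimension m < 2(n + 1), so they satisfy a
   nontrivial real relation [u]. Its two halves are the real and imaginary parts of the coefficients
   of a complex relation between the rows of [A]. *)
pose K := kermx (col_mx A (A *m J)).
have K0 : K != 0.
  rewrite kermx_eq0 /row_free; apply/negP => /eqP e.
  have := rank_leq_col (col_mx A (A *m J)); rewrite e leqNgt.
  by rewrite addnn mn.
have [i Ki] : exists i, row i K != 0.
  have [|Kr] := pselect (exists i, row i K != 0) => //.
  exfalso; move/eqP: K0; apply; apply/row_matrixP => i; rewrite row0.
  by apply/eqP; apply: contrapT => /negP h; apply: Kr; exists i.
pose u := row i K.
have uA : lsubmx u *m A + rsubmx u *m (A *m J) = 0.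
  have /sub_kermxP : (u <= K)%MS by exact: row_sub.
  by rewrite -[in X in X -> _](hsubmxK u) mul_row_col.
have [k uk] : exists k, (lsubmx u 0 k, rsubmx u 0 k) != (0, 0).
  have [|ur] := pselect (exists k, (lsubmx u 0 k, rsubmx u 0 k) != (0, 0)) => //.
  exfalso; move/eqP: Ki; apply; rewrite -/u -(hsubmxK u) -[RHS]row_mx0.
  have ur0 k : lsubmx u 0 k = 0 /\ rsubmx u 0 k = 0.
    have /negP/negPn/eqP[-> ->] // : ~ (lsubmx u 0 k, rsubmx u 0 k) != (0, 0).
    by move=> h; apply: ur; exists k.
  by congr row_mx; apply/rowP => k; rewrite [RHS]mxE; case: (ur0 k).
(* In slot [k], alternation kills every row of [A] except the k-th. Substituting the relation there
   leaves (p + 'i q) times the value at [A], with p + 'i q the nonzero coefficient found above. *)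
have Tsum (s : 'rV[R]_n.+1) : T k (s *m A) = (s 0 k)%:C%C * T k (row k A).
  rewrite mulmx_sum_row (big_morph (T k) (TD k) (T0 k)) (bigD1 k)//=.
  by rewrite TZ big1 ?addr0// => l lk; rewrite TZ Talt// mulr0.
have := congr1 (T k) uA.
rewrite TD T0 mulmxA TJ !Tsum mulrA -mulrDl => /eqP.
rewrite mulf_eq0 /T setrow_id => /orP[|/eqP//].
move: uk; rewrite xpair_eqE; set p := lsubmx _ _ _; set q := rsubmx _ _ _.
move=> pq /eqP; rewrite -[LHS](complexE (Complex p q)) => -[p0 q0].
by move: pq; rewrite p0 q0 eqxx.
Qed.
End WedgeJ.

(** * Functions of class C^k *)

Lemma open_near (T : topologicalType) (U : set T) (P : T -> Prop) (x : T) :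
  open U -> U x -> (forall y, U y -> P y) -> \forall y \near x, P y.
Proof. by move=> oU Ux UP; apply: filterS UP _; exact: open_nbhs_nbhs. Qed.

Section CkGeneric.
Context (R : realType) (V W : normedModType R).
Implicit Types (U : set V) (f g : V -> W) (k : nat).

Lemma Ck_on_ext k U f g : open U -> (forall x, U x -> f x = g x) ->
  Ck_on k U f -> Ck_on k U g.
Proof.
move=> oU; elim: k f g => [|k IH] f g fg /= [fc fd]; split.
- move=> x Ux; have := fc x Ux; rewrite /prop_for /continuous_at fg// => h.
  apply: cvg_trans h; apply: near_eq_cvg; apply: open_near oU Ux _ => y Uy.
  by rewrite fg.
- by [].
- move=> x Ux; have := fc x Ux; rewrite /prop_for /continuous_at fg// => h.
  apply: cvg_trans h; apply: near_eq_cvg; apply: open_near oU Ux _ => y Uy.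
  by rewrite fg.
- move=> v; have [fv1 fv2] := fd v; split.
    move=> x Ux; apply: near_eq_derivable (fv1 x Ux).
    exact: open_near oU Ux _.
  apply: IH fv2 => x Ux; apply: near_eq_derive.
  exact: open_near oU Ux _.
Qed.

Lemma Ck_on_sub k U U' f : U' `<=` U -> Ck_on k U f -> Ck_on k U' f.
Proof.
move=> UU; elim: k f => [|k IH] f /= [fc fd]; split => //.
- by move=> x /UU; exact: fc.
- by move=> x /UU; exact: fc.
- by move=> v; have [fv1 fv2] := fd v; split => [x /UU|]; [exact: fv1|exact: IH].
Qed.

Lemma Ck_onW k U f : Ck_on k.+1 U f -> Ck_on k U f.
Proof.
elim: k f => [|k IH] f [fc fd]; split => // v.
by have [fv1 fv2] := fd v; split => //; exact: IH.
Qed.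

Lemma Ck_on_le k l U f : (k <= l)%N -> Ck_on l U f -> Ck_on k U f.
Proof.
elim: l => [|l IH]; first by rewrite leqn0 => /eqP->.
by rewrite leq_eqVlt => /predU1P[->//|/IH h /Ck_onW].
Qed.

Lemma Ck_on_continuous k U f x : Ck_on k U f -> U x -> {for x, continuous f}.
Proof. by case: k => [|k] [fc _]; exact: fc. Qed.

Lemma Ck_on_derivable k U f x v : Ck_on k.+1 U f -> U x -> derivable f x v.
Proof. by case=> _ /(_ v)[h _]; exact: h. Qed.

Lemma Ck_on_derive k U f v : Ck_on k.+1 U f -> Ck_on k U (fun x => 'D_v f x).
Proof. by case=> _ /(_ v)[]. Qed.

Lemma Ck_on_cst k U (a : W) : Ck_on k U (fun=> a).
Proof.
elim: k a => [|k IH] a; split => //; try by move=> x _; exact: cvg_cst.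
move=> v; split; first by move=> x _; exact: derivable_cst.
have -> : (fun x => 'D_v (fun=> a) x) = (fun=> 0) :> (V -> W).
  by apply/funext => x; rewrite derive_cst.
exact: IH.
Qed.

Lemma Ck_on_add k U f g : open U -> Ck_on k U f -> Ck_on k U g ->
  Ck_on k U (fun x => f x + g x).
Proof.
move=> oU; elim: k f g => [|k IH] f g [fc fd] [gc gd]; split => //;
  try by move=> x Ux; apply: cvgD; [exact: fc|exact: gc].
move=> v; have [fv1 fv2] := fd v; have [gv1 gv2] := gd v; split.
  by move=> x Ux; apply: derivableD; [exact: fv1|exact: gv1].
apply: Ck_on_ext (IH _ _ fv2 gv2) => // x Ux.
by rewrite -deriveD//; [exact: fv1|exact: gv1].
Qed.

Lemma Ck_on_opp k U f : open U -> Ck_on k U f -> Ck_on k U (fun x => - f x).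
Proof.
move=> oU; elim: k f => [|k IH] f [fc fd]; split => //;
  try by move=> x Ux; apply: cvgN; exact: fc.
move=> v; have [fv1 fv2] := fd v; split.
  by move=> x Ux; apply: derivableN; exact: fv1.
apply: Ck_on_ext (IH _ fv2) => // x Ux.
by rewrite -deriveN//; exact: fv1.
Qed.

Lemma Ck_on_sum k U n (f : 'I_n -> V -> W) : open U ->
  (forall i, Ck_on k U (f i)) -> Ck_on k U (fun x => \sum_i f i x).
Proof.
move=> oU fC; rewrite (_ : (fun x => _) = \sum_i f i); last first.
  by apply/funext => x; rewrite fct_sumE.
elim/big_ind : _ => // [|g h]; first exact: Ck_on_cst.
exact: Ck_on_add.
Qed.

End CkGeneric.

Section CkReal.
Context (R : realType) (V : normedModType R).
Implicit Types (U : set V) (f g : V -> R^o) (k : nat).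

Lemma Ck_on_mul k U f g : open U -> Ck_on k U f -> Ck_on k U g ->
  Ck_on k U (fun x => f x * g x : R^o).
Proof.
move=> oU; elim: k f g => [|k IH] f g fC gC; split => //;
  try by move=> x Ux; apply: cvgM;
    [exact: Ck_on_continuous fC Ux|exact: Ck_on_continuous gC Ux].
move=> v; split.
  move=> x Ux; apply: derivableM; first exact: Ck_on_derivable fC Ux.
  exact: Ck_on_derivable gC Ux.
have := Ck_on_add oU (IH _ _ (Ck_onW fC) (Ck_on_derive v gC))
  (IH _ _ (Ck_onW gC) (Ck_on_derive v fC)).
apply: Ck_on_ext => // x Ux.
rewrite -[RHS]/('D_v (f * g) x) deriveM//.
  exact: Ck_on_derivable fC Ux.
exact: Ck_on_derivable gC Ux.
Qed.

Lemma Ck_on_inv k U f : open U -> (forall x, U x -> f x != 0) -> Ck_on k U f ->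
  Ck_on k U (fun x => (f x)^-1 : R^o).
Proof.
move=> oU f0; elim: k => [|k IH] fC; split => //;
  try by move=> x Ux; apply: cvgV; [exact: f0|exact: Ck_on_continuous fC Ux].
move=> v; split.
  by move=> x Ux; apply: derivableV; [exact: f0|exact: Ck_on_derivable fC Ux].
have fVC := IH (Ck_onW fC).
have := Ck_on_opp oU (Ck_on_mul oU (Ck_on_mul oU fVC fVC) (Ck_on_derive v fC)).
apply: Ck_on_ext => // x Ux.
rewrite deriveV; [|exact: f0|exact: Ck_on_derivable fC Ux].
by rewrite expr2 invfM scaleNr.
Qed.

End CkReal.

Lemma Ck_on_coord (R : realType) (V : normedModType R) (k m n : nat) (U : set V)
  (f : V -> 'M[R]_(m, n)) i j : open U ->
  Ck_on k U f -> Ck_on k U (fun x => f x i j : R^o).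
Proof.
move=> oU; elim: k f => [|k IH] f fC; split => //;
  try by move=> x Ux; 
    apply: (@continuous_comp _ _ R^o f (fun M : 'M[R]_(m, n) => M i j));
    [exact: Ck_on_continuous fC Ux|exact: coord_continuous].
move=> v; split.
  by move=> x Ux; have /derivable_mxP := Ck_on_derivable (v := v) fC Ux; exact.
apply: Ck_on_ext (IH _ (Ck_on_derive v fC)) => // x Ux.
by rewrite derive_mx ?mxE//; exact: Ck_on_derivable fC Ux.
Qed.

(** * Restriction to lines and the mean value theorem *)

Section Line.
Context (R : realType) (V : normedModType R).
Implicit Types (f : V -> R^o).

(** Both difference quotients are the same function of h. This transfers one-variable results, such
    as the mean value theorem, to directional derivatives. *)
Lemma is_derive_lineP (W : normedModType R) (f : V -> W) x v (t : R) (l : W) :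
  is_derive (t *: v + x) v f l <-> is_derive t 1 (fun s : R => f (s *: v + x)) l.
Proof.
have E : (fun h : R => h^-1 *: ((f \o shift (t *: v + x)) (h *: v) - f (t *: v + x))) =
  (fun h : R => h^-1 *: (((fun s : R => f (s *: v + x)) \o shift t)
    (h *: (1 : R^o)) - f (t *: v + x))).
  by apply/funext => h /=; rewrite addrA -scalerDl [h *: 1]mulr1.
by split=> -[]; rewrite /derivable /derive => df <-; split;
  move: df; rewrite /derivable /derive E.
Qed.

(** Only one directional derivative is assumed to exist, so the argument reparametrises the line
    instead of using linearity of a differential. *)
Lemma is_deriveZv f x v (a l : R) : is_derive x v f l ->
  is_derive x (a *: v) f (a * l).
Proof.
move=> fl.
have -> : x = 0 *: (a *: v) + x by rewrite scale0r add0r.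
apply/is_derive_lineP.
rewrite (_ : (fun s => _) =
  (fun s : R => f (s *: v + x)) \o (fun s => s * a)); last first.
  by apply/funext => s /=; rewrite scalerA.
rewrite mulrC; apply: is_derive1_comp.
  by apply/is_derive_lineP; rewrite mul0r scale0r add0r.
have := is_deriveM (is_derive_id (0 : R) 1) (is_derive_cst a (0 : R) 1).
by rewrite scaler0 add0r [_ *: _]mulr1.
Qed.

Lemma MVT_line f x v : (forall t : R, 0 <= t <= 1 -> derivable f (x + t *: v) v) ->
  exists2 t : R, 0 < t < 1 & f (x + v) - f x = 'D_v f (x + t *: v).
Proof.
move=> df; pose phi (t : R) : R := f (t *: v + x).
have dphi (t : R) : 0 <= t <= 1 -> is_derive t 1 phi ('D_v f (x + t *: v)).
  by move=> t01; apply/is_derive_lineP; rewrite addrC; apply: derivableP; exact: df.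
have [||t t01] := @MVT R phi (fun t => 'D_v f (x + t *: v)) 0 1 ltr01.
- move=> t; rewrite in_itv /= => /andP[t0 t1]; apply: dphi.
  by rewrite !ltW.
- apply: derivable_within_continuous => t; rewrite in_itv /= => t01.
  by have [] := dphi t t01.
rewrite /phi scale1r scale0r add0r subr0 mulr1 addrC [v + x]addrC => h.
by exists t => //; rewrite -h addrC.
Qed.
End Line.

(** * Total differentiability from continuous partial derivatives *)

Section Linform.
Context (R : realType) (m : nat) (D : 'cV[R]_m).
(** The candidate differential, [D] being the column of partial derivatives; it is made a bundled
    linear map so that [diff_unique] applies. *)
Definition linform (k : 'rV[R]_m) : R^o := (k *m D) 0 0.
Lemma linform_is_linear : linear linform.
Proof. by move=> a u v; rewrite /linform mulmxDl -scalemxAl !mxE. Qed.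
HB.instance Definition _ :=
  GRing.isLinear.Build R 'rV[R]_m R^o _ linform linform_is_linear.

Lemma linformE k : linform k = \sum_j k 0 j * D j 0.
Proof. by rewrite /linform mxE. Qed.

Lemma linform_continuous : continuous linform.
Proof.
rewrite (_ : linform = fun k => \sum_j k 0 j * D j 0); last first.
  by apply/funext => k; rewrite linformE.
move=> x.
apply: (@Ck_on_continuous R 'rV[R]_m R^o 0 setT) => //.
have := @Ck_on_sum R 'rV[R]_m R^o 0 setT m (fun j k => k 0 j * D j 0) openT.
apply => j.
apply: Ck_on_mul; [exact: openT| |exact: Ck_on_cst].
apply: (@Ck_on_coord R _ 0 1 m setT id); first exact: openT.
by split => // z _; exact: cvg_id.
Qed.
End Linform.

Lemma row_norm_coord (R : realType) (m : nat) (k : 'rV[R]_m) j : `|k 0 j| <= `|k|.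
Proof.
rewrite [leRHS]/Num.Def.normr/= mx_normrE.
exact: (le_bigmax _ (fun ij => `|k ij.1 ij.2|) (0, j)).
Qed.

(** [Ck_on] records directional derivatives only. The total differential obtained here is what gives
    linearity in the direction and the chain rule. *)
Lemma C1_differentiable (R : realType) (m : nat) (U : set 'rV[R]_m)
  (h : 'rV[R]_m -> R^o) (y : 'rV[R]_m) : open U -> Ck_on 1 U h -> U y ->
  differentiable h y /\
  'd h y = linform (\col_j 'D_(delta_mx 0 j) h y) :> ('rV[R]_m -> R^o).
Proof.
move=> oU hC Uy; set D := \col_j _.
suff hE (e : R) : 0 < e -> \forall k \near (0 : 'rV[R]_m),
    `|h (k + y) - (h y + linform D k)| <= e * `|k|.
  have dE : 'd h y = linform D :> ('rV[R]_m -> R^o).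
    apply: diff_unique; first exact: linform_continuous.
    by apply/eqaddoP => _/posnumP[e]; exact: hE.
  split => //; apply/diff_locallyP; rewrite dE; split.
    exact: linform_continuous.
  by apply/eqaddoP => _/posnumP[e]; exact: hE.
move=> e0.
(* Each of the m coordinate steps contributes an error of at most e' |k|; dividing by m + 1 rather
   than m also covers m = 0. *)
pose e' := e / m.+1%:R.
have e'0 : 0 < e' by rewrite divr_gt0.
have nU : \forall z \near y, U z /\ forall j : 'I_m,
    `|'D_(delta_mx 0 j) h z - 'D_(delta_mx 0 j) h y| <= e'.
  near=> z; split; first by near: z; exact: open_nbhs_nbhs.
  near: z; apply: filter_forall => j.
  have := Ck_on_continuous (Ck_on_derive (delta_mx 0 j) hC) Uy.
  by move=> /cvgrPdist_le/(_ _ e'0); apply: filterS => z; rewrite distrC.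
have [d /= d0 dU] := (nbhs_ballP _ _).1 nU.
apply/nbhs_ballP; exists d => //= k.
rewrite -ball_normE /= sub0r normrN => kd.
pose P j : 'rV[R]_m := \row_i (if (i < j)%N then k 0 i else 0).
(* telescoping along the coordinates, the mean value theorem at each step *)
have key j : (j <= m)%N ->
    `|h (y + P j) - h y -
      \sum_(i < m | (i < j)%N) k 0 i * 'D_(delta_mx 0 i) h y|
    <= j%:R * (e' * `|k|).
  elim: j => [|j IH] jm.
    rewrite (_ : P 0%N = 0); last by apply/rowP => i; rewrite !mxE.
    by rewrite addr0 subrr big_pred0// subr0 normr0 mul0r.
  pose o := Ordinal jm.
  have PE : P j.+1 = P j + k 0 o *: delta_mx 0 o.
    apply/rowP => i; rewrite !mxE eqxx /= ltnS leq_eqVlt.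
    rewrite -(val_eqE i o) /=; have [ij|] := eqVneq (val i) j.
      by rewrite /= ij ltnn add0r mulr1; congr (k 0 _); exact: val_inj.
    by rewrite /= mulr0 addr0.
  (* For the sup norm, truncating [k] and shrinking one coordinate does not increase the norm, so
     the whole step stays in the ball. *)
  have inU (t : R) : 0 <= t <= 1 -> ball y d (y + P j + t *: (k 0 o *: delta_mx 0 o)).
    move=> /andP[t0 t1]; rewrite -ball_normE /=.
    rewrite -addrA opprD addNKr normrN.
    apply: le_lt_trans kd; rewrite [leLHS]/Num.Def.normr/= mx_normrE.
    apply/bigmax_leP; split => // -[a i] _ /=; rewrite !mxE (ord1 a) eqxx /=.
    rewrite -(val_eqE i o) /=; case: eqP => [ij|ij].
      rewrite ij ltnn add0r mulr1 normrM (ger0_norm t0).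
      by rewrite (le_trans _ (row_norm_coord k o))// ler_piMl.
    rewrite !mulr0 addr0; case: ifP => _; first exact: row_norm_coord.
    by rewrite normr0.
  have [|t /andP[t0 t1] tE] := @MVT_line R _ h (y + P j) (k 0 o *: delta_mx 0 o).
    move=> t t01; apply: Ck_on_derivable hC _.
    by have [] := dU _ (inU t t01).
  have t01 : 0 <= t <= 1 by rewrite !ltW.
  have [Uz /(_ o) Dz] := dU _ (inU t t01).
  move: tE; set z := y + P j + _ in Uz Dz *.
  have [_ ->] := is_deriveZv (k 0 o)
    (derivableP (Ck_on_derivable (v := delta_mx 0 o) hC Uz)).
  rewrite -addrA -PE => tE.
  rewrite (bigD1 o) //=.
  rewrite (eq_bigl (fun i : 'I_m => (i < j)%N)); last first.
    by move=> i; rewrite ltnS -val_eqE /= andbC ltn_neqAle.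
  set S := \sum_(_ | _) _ in IH *.
  rewrite (_ : _ - _ - _ = (h (y + P j) - h y - S) +
    (k 0 o * ('D_(delta_mx 0 o) h z - 'D_(delta_mx 0 o) h y))); last first.
    have -> : h (y + P j.+1) = h (y + P j) + k 0 o * 'D_(delta_mx 0 o) h z.
      by rewrite -tE [RHS]addrC subrK.
    by ring.
  rewrite (le_trans (ler_normD _ _))// -natr1 mulrDl mul1r lerD//.
    by apply: IH; exact: ltnW.
  rewrite normrM mulrC; apply: ler_pM => //.
  exact: row_norm_coord.
have := key m (leqnn m).
have -> : P m = k by apply/rowP => i; rewrite !mxE ltn_ord.
rewrite (eq_bigl predT); last by move=> i; rewrite ltn_ord.
move=> H; rewrite opprD addrA addrC.
rewrite (_ : linform D k = \sum_(i < m) k 0 i * 'D_(delta_mx 0 i) h y); last first.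
  by rewrite linformE; apply: eq_bigr => i _; rewrite !mxE.
rewrite [_ + (_ - _)]addrC [k + y]addrC; apply: (le_trans H).
rewrite mulrA ler_wpM2r// /e' mulrCA ger_pMr//.
by rewrite ler_pdivrMr// mul1r ler_nat.
Unshelve. all: by end_near. Qed.

(** * Chain rule, symmetry of second derivatives, local maxima *)

Lemma ler_dist_half (R : realFieldType) (a b p e : R) :
  `|a - p| <= e / 2 -> `|b - p| <= e / 2 -> `|a - b| <= e.
Proof.
move=> ap bp; rewrite -(subrKA p) (splitr e) (le_trans (ler_normD _ _))//.
by rewrite lerD// distrC.
Qed.

Section C1.
Context (R : realType) (m : nat) (U : set 'rV[R]_m) (h : 'rV[R]_m -> R^o).
Hypotheses (oU : open U) (hC : Ck_on 1 U h).

Lemma C1_deriveE (x v : 'rV[R]_m) : U x ->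
  'D_v h x = \sum_j v 0 j * 'D_(delta_mx 0 j) h x.
Proof.
move=> Ux; have [dh dE] := C1_differentiable oU hC Ux.
by rewrite deriveE// dE linformE; apply: eq_bigr => j _; rewrite !mxE.
Qed.

Lemma C1_derive_linear (x : 'rV[R]_m) : U x -> linear (fun v => 'D_v h x : R^o).
Proof.
move=> Ux a u v; have [dh dE] := C1_differentiable oU hC Ux.
by rewrite !deriveE// linearP.
Qed.

(** [f] is only assumed derivable along [v]. Restricted to the line it depends on one real variable,
    where derivable and differentiable agree, and the chain rule for differentials applies. *)
Lemma C1_chain (V : normedModType R) (f : V -> 'rV[R]_m) (x v : V) (l : 'rV[R]_m) :
  U (f x) -> is_derive x v f l -> is_derive x v (h \o f : V -> R^o) ('D_l h (f x)).
Proof.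
move=> Ufx; have {1 2}-> : x = 0 *: v + x by rewrite scale0r add0r.
move=> /is_derive_lineP fl; apply/is_derive_lineP.
set phi := fun s : R => f _ in fl.
have [dh _] := C1_differentiable oU hC Ufx.
have phi0 : phi 0 = f x by rewrite /phi scale0r add0r.
have dphi : differentiable phi 0 by apply/derivable1_diffP; case: fl.
have dhphi : differentiable (h \o phi) (0 : R).
  by apply: differentiable_comp => //; rewrite phi0.
have E : 'D_1 (h \o phi) (0 : R) = 'D_l h (f x).
  rewrite deriveE// diff_comp//=; last by rewrite phi0.
  by rewrite phi0 [RHS]deriveE// -[in LHS](deriveE _ dphi); case: fl => _ ->.
by split; [exact/derivable1_diffP|].
Qed.

End C1.

(** Induction on k through D_v (h o f) = \sum_j (D_v f)_j (D_j h o f): the induction hypothesis is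
    applied to each partial derivative of [h]. *)
Lemma Ck_on_comp (R : realType) (V : normedModType R) (m k : nat) (U : set V)
  (U' : set 'rV[R]_m) (f : V -> 'rV[R]_m) (h : 'rV[R]_m -> R^o) :
  open U -> open U' -> (forall x, U x -> U' (f x)) ->
  Ck_on k U f -> Ck_on k U' h -> Ck_on k U (h \o f : V -> R^o).
Proof.
move=> oU oU' fU; elim: k h => [|k IH] h fC hC; split => //;
  try by move=> x Ux; apply: continuous_comp;
    [exact: Ck_on_continuous fC Ux|exact: Ck_on_continuous hC (fU _ Ux)].
have h1C := Ck_on_le (ltn0Sn k) hC.
have chain x v : U x -> is_derive x v (h \o f : V -> R^o) ('D_('D_v f x) h (f x)).
  move=> Ux; apply: (C1_chain oU' h1C); first exact: fU.
  by apply: derivableP; exact: Ck_on_derivable fC Ux.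
move=> v; split; first by move=> x Ux; have [] := chain x v Ux.
apply: (@Ck_on_ext R V R^o k U
  (fun x => \sum_j 'D_v f x 0 j * ('D_(delta_mx 0 j) h \o f) x)) => //.
  move=> x Ux; have [_ ->] := chain x v Ux.
  by rewrite (C1_deriveE oU' h1C)//; exact: fU.
apply: Ck_on_sum => // j; apply: Ck_on_mul => //.
  exact: Ck_on_coord oU (Ck_on_derive v fC).
by apply: IH; [exact: Ck_onW|exact: Ck_on_derive].
Qed.

(** * Second derivatives and local maxima *)

Section SecondDerivative.
Context (R : realType) (V : normedModType R) (U : set V) (f : V -> R^o).
Hypotheses (oU : open U) (fC : Ck_on 2 U f).

(** The mean value theorem is used twice: along [v] for y |-> f (y + w) - f y, then along [w] for
    ['D_v f]. *)
Lemma second_difference (x v w : V) :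
  (forall s t : R, 0 <= s <= 1 -> 0 <= t <= 1 -> U (x + s *: v + t *: w)) ->
  exists s t : R, [/\ 0 <= s <= 1, 0 <= t <= 1 &
   f (x + v + w) - f (x + v) - (f (x + w) - f x) =
   'D_w (fun y => 'D_v f y) (x + s *: v + t *: w)].
Proof.
move=> inU.
pose F y := f (y + w) - f y.
have dw y : U (y + w) -> is_derive y v (fun y => f (y + w) : R^o) ('D_v f (y + w)).
  move=> Uyw.
  have : is_derive (y + w) v f ('D_v f (y + w)).
    by apply: derivableP; exact: Ck_on_derivable fC Uyw.
  rewrite -{1}(add0r (y + w)) -{1}(scale0r v) => /is_derive_lineP H.
  rewrite -{1}(add0r y) -{1}(scale0r v); apply/is_derive_lineP.
  rewrite (_ : (fun s : R => f (s *: v + y + w)) = fun s : R => f (s *: v + (y + w)))//.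
  by apply/funext => s; rewrite addrA.
have U0 s : 0 <= s <= 1 -> U (x + s *: v).
  move=> s01; have := inU s 0 s01; rewrite scale0r addr0; apply.
  by rewrite lexx ler01.
have U1 s : 0 <= s <= 1 -> U (x + s *: v + w).
  move=> s01; have := inU s 1 s01; rewrite scale1r; apply.
  by rewrite lexx ler01.
have dF s : 0 <= s <= 1 ->
    is_derive (x + s *: v) v F ('D_v f (x + s *: v + w) - 'D_v f (x + s *: v)).
  move=> s01; apply: is_deriveB; first by apply: dw; exact: U1.
  by apply: derivableP; apply: Ck_on_derivable fC _; exact: U0.
have [|s /andP[s0 s1] sE] := @MVT_line R V F x v.
  by move=> s s01; have [] := dF s s01.
have s01 : 0 <= s <= 1 by rewrite !ltW.
have [|t /andP[t0 t1] tE] := @MVT_line R V (fun y => 'D_v f y) (x + s *: v) w.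
  by move=> t t01; apply: Ck_on_derivable (Ck_on_derive v fC) _; exact: inU.
exists s, t; split => //; first by rewrite !ltW.
rewrite -tE; have [_ <-] := dF s s01.
by rewrite -sE /F.
Qed.

(* The second difference of f at x along r v and r w is symmetric in v and w. *)
Lemma derive_comm (x v w : V) : U x ->
  'D_v (fun y => 'D_w f y) x = 'D_w (fun y => 'D_v f y) x.
Proof.
move=> Ux.
have cv := Ck_on_continuous (Ck_on_derive v (Ck_on_derive w fC)) Ux.
have cw := Ck_on_continuous (Ck_on_derive w (Ck_on_derive v fC)) Ux.
rewrite /prop_for /continuous_at in cv cw.
move: cv cw; move: ('D_v _ x) ('D_w _ x) => a b cv cw.
apply/eqP; rewrite -subr_eq0 -normr_le0.
apply/ler_addgt0Pr => e e0; rewrite add0r.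
have e2 : 0 < e / 2 by rewrite divr_gt0.
have nU : \forall z \near x, [/\ U z, `|a - 'D_v (fun y => 'D_w f y) z| <= e / 2 &
    `|b - 'D_w (fun y => 'D_v f y) z| <= e / 2].
  move/cvgrPdist_le : cv => /(_ _ e2) cv; move/cvgrPdist_le : cw => /(_ _ e2) cw.
  have nUx : nbhs x U by exact: open_nbhs_nbhs.
  apply: filterS (filterI nUx (filterI cv cw)) => z [Uz [az bz]].
  exact: And3 Uz az bz.
have [d /= d0 dU] := (nbhs_ballP _ _).1 nU.
(* [r] shrinks the parallelogram spanned by r v and r w until it fits in the ball of radius [d]. *)
have [r r0 rE] : exists2 r : R, 0 < r & r * (`|v| + `|w|) < d.
  have c0 : 0 < `|v| + `|w| + 1 by rewrite ltr_wpDl// addr_ge0.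
  exists (d / (`|v| + `|w| + 1)); first by rewrite divr_gt0.
  by rewrite mulrAC -mulrA gtr_pMr// ltr_pdivrMr// mul1r ltrDl.
have inball (s t : R) : 0 <= s <= 1 -> 0 <= t <= 1 ->
    ball x d (x + s *: (r *: v) + t *: (r *: w)).
  move=> /andP[s0 s1] /andP[t0 t1]; rewrite -ball_normE /= -addrA opprD addNKr normrN.
  rewrite (le_lt_trans (ler_normD _ _))// !normrZ.
  rewrite (ger0_norm s0) (ger0_norm t0) (gtr0_norm r0).
  apply: le_lt_trans rE.
  by rewrite mulrDr lerD// ?ler_piMl// mulr_ge0// ltW.
have [|s [t [s01 t01 E1]]] := @second_difference x (r *: v) (r *: w).
  by move=> s t s01 t01; have [] := dU _ (inball _ _ s01 t01).
have [|t' [s' [t01' s01' E2]]] := @second_difference x (r *: w) (r *: v).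
  by move=> t' s' t01' s01'; rewrite addrAC; have [] := dU _ (inball _ _ s01' t01').
have [U1 _ B1] := dU _ (inball _ _ s01 t01).
have := inball _ _ s01' t01'; rewrite addrAC => /dU[U2 B2 _].
set z1 := _ + _ in U1 B1 E1; set z2 := _ + _ in U2 B2 E2.
have DD z u u' : U z -> 'D_(r *: u) (fun y => 'D_(r *: u') f y) z =
    r * (r * 'D_u (fun y => 'D_u' f y) z).
  move=> Uz.
  rewrite (@near_eq_derive _ _ _ _ (fun y => r * 'D_u' f y : R^o)); last first.
    apply: open_near oU Uz _ => y Uy.
    by have [_ ->] := is_deriveZv r (derivableP (Ck_on_derivable (v := u') fC Uy)).
  have du := Ck_on_derivable (v := u) (Ck_on_derive u' fC) Uz.
  have dru := is_deriveZv r (derivableP du).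
  have [_ ->] :=
    is_deriveZv r (is_deriveM (is_derive_cst (r : R^o) z u) (derivableP du)).
  by rewrite scaler0 addr0.
(* Each side, taken at its own intermediate point, is the common second difference divided by r ^
   2. *)
have E3 : 'D_v (fun y => 'D_w f y) z2 = 'D_w (fun y => 'D_v f y) z1.
  apply: (mulfI (lt0r_neq0 r0)); apply: (mulfI (lt0r_neq0 r0)).
  rewrite (DD _ _ _ U1) in E1; rewrite (DD _ _ _ U2) in E2.
  apply: etrans (esym E2) (etrans _ E1).
  rewrite [x + r *: w + _]addrAC.
  move: (f (x + r *: v + r *: w)) (f (x + r *: v)) (f (x + r *: w)) (f x) => A B C D.
  by rewrite opprB opprB addrACA [in RHS]addrACA [- C + - B]addrC.
rewrite E3 in B2; exact: ler_dist_half B2 B1.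
Qed.

Lemma near_line (P : set V) (x v : V) : nbhs x P ->
  exists2 r : R, 0 < r & forall s : R, `|s| <= r -> P (s *: v + x).
Proof.
move=> /nbhs_ballP[d /= d0 dP].
have v0 : 0 < `|v| + 1 by rewrite ltr_wpDl.
exists (d / (`|v| + 1)) => [|s sr]; first by rewrite divr_gt0.
apply: dP; rewrite -ball_normE /= opprD addrCA subrr addr0 normrN normrZ.
apply: (@le_lt_trans _ _ (d / (`|v| + 1) * `|v|)); first by rewrite ler_wpM2r.
by rewrite mulrAC -mulrA gtr_pMr// ltr_pdivrMr// mul1r ltrDl.
Qed.

Lemma derive_local_max (x v : V) : U x -> (\forall y \near x, f y <= f x) ->
  'D_v f x = 0.
Proof.
move=> Ux xmax.
have nUx : nbhs x U by exact: open_nbhs_nbhs.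
have [r r0 rP] := near_line v (filterI nUx xmax).
have df (s : R) : U (s *: v + x) ->
    is_derive s 1 (fun s : R => f (s *: v + x)) ('D_v f (s *: v + x)).
  move=> Us; apply: (is_derive_lineP f x v s _).1.
  exact: derivableP (Ck_on_derivable fC Us).
have rr s : s \in `]-r, r[%R -> `|s| <= r.
  by rewrite in_itv /= ler_norml => /andP[/ltW-> /ltW->].
have := @derive1_at_max R (fun s : R => f (s *: v + x)) (-r) r 0.
have -> : - r <= r by rewrite (@le_trans _ _ 0)// ?oppr_le0 ltW.
case=> //.
- by move=> t /rr/rP[Ut _]; have [] := df t Ut.
- by rewrite in_itv /= oppr_lt0 r0.
- by move=> t /rr/rP[_]; rewrite scale0r add0r.
have [|_] := df 0; first by rewrite scale0r add0r.
by rewrite scale0r add0r => -> _ ->.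
Qed.

(** Otherwise, as ['D_v f x = 0], the derivative ['D_v f] would be positive at x + s v for small s >
    0, and the mean value theorem would give f (x + q v) > f x for some small q > 0. *)
Lemma derive2_local_max (x v : V) : U x -> (\forall y \near x, f y <= f x) ->
  'D_v (fun y => 'D_v f y) x <= 0.
Proof.
move=> Ux xmax; rewrite leNgt; apply/negP => D2.
have D1 := derive_local_max v Ux xmax.
have nUx : nbhs x U by exact: open_nbhs_nbhs.
have [r r0 rP] := near_line v (filterI nUx xmax).
have := Ck_on_derivable (v := v) (Ck_on_derive v fC) Ux.
move=> /cvgr_gt/(_ _ D2)/nbhs_ballP[d /= d0 dP].
have [q [q0 qr qd]] : exists q : R, [/\ 0 < q, q <= r & q < d].
  exists (Num.min r (d / 2)); split; first by rewrite lt_min r0 divr_gt0.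
    by rewrite ge_min lexx.
  by rewrite gt_min ltr_pdivrMr// ltr_pMr// ltr1n orbT.
have [|t /andP[t0 t1] tE] := @MVT_line R V f x (q *: v).
  move=> t /andP[t0 t1]; have [|Ut _] := rP (t * q).
    by rewrite normrM (ger0_norm t0) (gtr0_norm q0) (le_trans _ qr)// ler_piMl// ltW.
  by rewrite addrC scalerA; exact: Ck_on_derivable fC Ut.
have tq0 : 0 < t * q by rewrite mulr_gt0.
have tqr : t * q <= q by rewrite ler_piMl// ltW.
have [|Ut _] := rP (t * q).
  by rewrite gtr0_norm// (le_trans tqr).
have [|_] := rP q; first by rewrite gtr0_norm.
apply/negP; rewrite -ltNge -subr_gt0 [_ *: _ + x]addrC tE scalerA addrC.
have [_ ->] := is_deriveZv q (derivableP (Ck_on_derivable (v := v) fC Ut)).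
rewrite mulr_gt0//.
have := dP (t * q); rewrite /ball /= sub0r normrN gtr0_norm//.
have -> : t * q < d by rewrite (le_lt_trans tqr).
move=> /(_ isT); rewrite gt_eqF// => /(_ isT).
by rewrite D1 subr0 [_ *: _]mulrC pmulr_lgt0// invr_gt0.
Qed.

End SecondDerivative.

(** * The maximum principle for the Cauchy-Riemann equations *)

Lemma derive_sumE (R : realType) (V : normedModType R) (N : nat)
  (h : 'I_N -> V -> R^o) (x v : V) : (forall i, derivable (h i) x v) ->
  'D_v (fun y => \sum_i h i y : R^o) x = \sum_i 'D_v (h i) x.
Proof.
move=> dh; rewrite -derive_sum//; congr ('D_v _ x).
by apply/funext => y; rewrite fct_sumE.
Qed.

Lemma derive_sqr (R : realType) (V : normedModType R) (f : V -> R^o) (x v : V) :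
  derivable f x v -> 'D_v (fun y => f y ^+ 2 : R^o) x = 2 * (f x * 'D_v f x).
Proof.
move=> df; rewrite -[LHS]/('D_v (f ^+ 2) x) deriveX//.
by rewrite expr1 mulr_natl [_ *: _]mulrnAl mulr_natl.
Qed.

Lemma derive2_sqr (R : realType) (V : normedModType R) (U : set V)
  (f : V -> R^o) (x v : V) :
  open U -> Ck_on 2 U f -> U x ->
  'D_v (fun z => 'D_v (fun y => f y ^+ 2 : R^o) z) x =
  2 * (f x * 'D_v (fun z => 'D_v f z) x) + 2 * ('D_v f x) ^+ 2.
Proof.
move=> oU fC Ux.
rewrite (@near_eq_derive _ _ _ _ (2 \*o (f * (fun y => 'D_v f y)) : V -> R^o));
  last first.
  apply: (open_near oU Ux) => y Uy; apply: derive_sqr.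
  exact: Ck_on_derivable fC Uy.
have df := Ck_on_derivable (v := v) fC Ux.
have ddf := Ck_on_derivable (v := v) (Ck_on_derive v fC) Ux.
rewrite (deriveMl _ (derivableM df ddf)) (deriveM df ddf).
move: ('D_v _ x) ('D_v f x) (f x) => a b c.
by rewrite mulrDr expr2.
Qed.

Lemma Ck_on_vmulmx (R : realType) (V : normedModType R) (k m n : nat) (U : set V)
  (J : V -> 'M[R]_(m, n)) (v : 'rV[R]_m) j : open U -> Ck_on k U J ->
  Ck_on k U (fun x => (v *m J x) 0 j : R^o).
Proof.
move=> oU JC.
apply: (@Ck_on_ext R V R^o k U (fun x => \sum_i v 0 i * J x i j)) => //.
  by move=> x _; rewrite mxE.
apply: Ck_on_sum => // i; apply: Ck_on_mul => //; first exact: Ck_on_cst.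
exact: Ck_on_coord.
Qed.

Lemma derivable_vmulmx (R : realType) (V : normedModType R) (m n : nat) (U : set V)
  (J : V -> 'M[R]_(m, n)) (v : 'rV[R]_m) x w : open U -> Ck_on 1 U J -> U x ->
  derivable (fun x => v *m J x) x w.
Proof.
move=> oU JC Ux; apply/derivable_mxP => i j; rewrite (ord1 i).
exact: Ck_on_derivable (Ck_on_vmulmx v j oU JC) Ux.
Qed.

(** Product rule for \sum_j K_j D_j f: the variation of the field [K] contributes the first-order
    term. *)
Lemma derive_along_field (R : realType) (m : nat) (U : set 'rV[R]_m)
  (f : 'rV[R]_m -> R^o) (K : 'rV[R]_m -> 'rV[R]_m) (x v : 'rV[R]_m) :
  open U -> Ck_on 2 U f -> U x -> derivable K x v ->
  'D_v (fun y => 'D_(K y) f y) x =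
  'D_v (fun y => 'D_(K x) f y) x + 'D_('D_v K x) f x.
Proof.
move=> oU fC Ux dK.
have f1C := Ck_onW fC.
have dKj j : derivable (fun y => K y 0 j : R^o) x v by have /derivable_mxP := dK; exact.
have dfj j : derivable (fun y => 'D_(delta_mx 0 j) f y) x v.
  exact: Ck_on_derivable (Ck_on_derive _ fC) Ux.
have expand (L : 'rV[R]_m -> 'rV[R]_m) :
    'D_v (fun y => 'D_(L y) f y) x =
    'D_v (fun y => \sum_j L y 0 j * 'D_(delta_mx 0 j) f y : R^o) x.
  apply: near_eq_derive; apply: (open_near oU Ux) => y Uy.
  exact: (C1_deriveE oU f1C).
rewrite (expand K) (expand (fun=> K x)) (C1_deriveE oU f1C)//.
rewrite derive_sumE => [|j]; last exact: (derivableM (dKj j) (dfj j)).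
rewrite derive_sumE => [|j]; last exact: (derivableM (derivable_cst _ _ _) (dfj j)).
rewrite -big_split; apply: eq_bigr => j _ /=.
rewrite -[X in X = _]/('D_v
  ((fun y => K y 0 j : R^o) * (fun y => 'D_(delta_mx 0 j) f y)) x).
rewrite -[X in _ = X + _]/('D_v
  ((fun=> K x 0 j : R^o) * (fun y => 'D_(delta_mx 0 j) f y)) x).
rewrite (deriveM (dKj j) (dfj j)) (deriveM (derivable_cst _ _ _) (dfj j)).
rewrite derive_cst scaler0 addr0 derive_mx// mxE.
by congr (_ + _); rewrite [_ *: _]mulrC.
Qed.

(** The letters stand for derivatives of u and s: indices 1 and 2 for the directions v and w = Jv,
    double letters for second derivatives, [du] and [ds] for derivatives along the drift. The third
    line is the derivative of u ^ 2 + s ^ 2 along J applied to the drift, rewritten by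
    Cauchy-Riemann. *)
Lemma laplacian_sqr_algebra (K : comPzRingType)
  (u s u1 s1 u2 s2 uvv uww svv sww ds du : K) :
  uvv + uww = ds -> svv + sww = - du ->
  2 * (u * uvv) + 2 * u1 ^+ 2 + (2 * (s * svv) + 2 * s1 ^+ 2) +
  (2 * (u * uww) + 2 * u2 ^+ 2 + (2 * (s * sww) + 2 * s2 ^+ 2)) +
  (2 * (u * - ds) + 2 * (s * du)) =
  2 * (u1 ^+ 2 + s1 ^+ 2 + u2 ^+ 2 + s2 ^+ 2).
Proof.
move=> <- e; have -> : du = - (svv + sww) by rewrite e opprK.
by ring.
Qed.

Section CauchyRiemann.
Context (R : realType) (m : nat) (U : set 'rV[R]_m) (J : 'rV[R]_m -> 'M[R]_m).
Context (x : 'rV[R]_m).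
Hypotheses (oU : open U) (JC : Ck_on 1 U J) (Ux : U x) (JJ : J x *m J x = - 1%:M).

Definition cauchy_riemann (u s : 'rV[R]_m -> R^o) :=
  forall y v, U y -> 'D_(v *m J y) u y = - 'D_v s y /\ 'D_(v *m J y) s y = 'D_v u y.

(* The vector b such that D_v D_v u + D_w D_w u = D_b s, w = Jv, whenever
   u + 'i s is holomorphic; it only involves J and its first derivatives. *)
Definition drift (v : 'rV[R]_m) : 'rV[R]_m :=
  'D_v (fun y => v *m J y) x + 'D_(v *m J x) (fun y => (v *m J x) *m J y) x.

(** Replace each inner derivative of u by a derivative of s along the field J. Since JJv = - v at x,
    the mixed second derivatives of s cancel by symmetry, and what remains comes from
    differentiating J. *)
Lemma drift_laplacian (u s : 'rV[R]_m -> R^o) v : Ck_on 2 U s ->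
  (forall y w, U y -> 'D_(w *m J y) s y = 'D_w u y) ->
  'D_v (fun y => 'D_v u y) x + 'D_(v *m J x) (fun y => 'D_(v *m J x) u y) x =
  'D_(drift v) s x.
Proof.
move=> sC us; set w := v *m J x.
have wJ : w *m J x = - v by rewrite /w -mulmxA JJ mulmxN mulmx1.
have e z : 'D_z (fun y => 'D_z u y) x = 'D_z (fun y => 'D_(z *m J y) s y) x.
  by apply: near_eq_derive; apply: (open_near oU Ux) => y Uy; rewrite us.
have e' z : 'D_z (fun y => 'D_z u y) x = 'D_z (fun y => 'D_(z *m J x) s y) x +
     'D_('D_z (fun y => z *m J y) x) s x.
  rewrite e; apply: (derive_along_field (K := fun y => z *m J y) oU sC Ux).
  exact: derivable_vmulmx JC Ux.
rewrite !e' wJ -/w /drift -/w.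
have := C1_derive_linear oU (Ck_onW sC) Ux 1
  ('D_v (fun y => v *m J y) x) ('D_w (fun y => w *m J y) x).
rewrite !scale1r => ->.
have -> : 'D_w (fun y => 'D_(- v) s y) x = - 'D_w (fun y => 'D_v s y) x.
  have dd := Ck_on_derivable (v := w) (Ck_on_derive v sC) Ux.
  rewrite -deriveN//; apply: near_eq_derive; apply: (open_near oU Ux) => y Uy.
  have [_] := is_deriveZv (-1) (derivableP (Ck_on_derivable (v := v) sC Uy)).
  by rewrite scaleN1r mulN1r.
rewrite (derive_comm oU sC v w Ux).
move: ('D_w _ x) ('D_('D_v _ x) _ x) ('D_('D_w _ x) _ x) => a b c.
by rewrite addrACA subrr add0r.
Qed.

(** The term along [drift v *m J x] is the correction that absorbs u D_b s - s D_b u, with b the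
    drift, left over from the two Laplacians. *)
Lemma laplacian_sqr_norm (u s : 'rV[R]_m -> R^o) (v : 'rV[R]_m) :
  Ck_on 2 U u -> Ck_on 2 U s -> cauchy_riemann u s ->
  let psi y : R^o := u y ^+ 2 + s y ^+ 2 in
  'D_v (fun y => 'D_v psi y) x + 'D_(v *m J x) (fun y => 'D_(v *m J x) psi y) x
  + 'D_(drift v *m J x) psi x =
  2 * ('D_v u x ^+ 2 + 'D_v s x ^+ 2 + 'D_(v *m J x) u x ^+ 2 + 'D_(v *m J x) s x ^+ 2).
Proof.
move=> uC sC cr psi; set w := v *m J x.
have uu := drift_laplacian v sC (fun y w Uy => (cr y w Uy).2).
(* The previous lemma for - 'i (u + 'i s), with real part s and imaginary part - u. *)
have ss : 'D_v (fun y => 'D_v s y) x + 'D_w (fun y => 'D_w s y) x = - 'D_(drift v) u x.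
  have nuC := Ck_on_opp oU uC.
  rewrite (@drift_laplacian s (fun y => - u y) v nuC).
    by rewrite deriveN//; exact: Ck_on_derivable uC Ux.
  move=> y z Uy; rewrite deriveN; last exact: Ck_on_derivable uC Uy.
  by rewrite (cr y z Uy).1 opprK.
have sqC (f : 'rV[R]_m -> R^o) : Ck_on 2 U f -> Ck_on 2 U (fun y => f y ^+ 2 : R^o).
  by move=> fC; exact: Ck_on_mul.
have psi1 z y : U y -> 'D_z psi y =
    'D_z (fun y => u y ^+ 2 : R^o) y + 'D_z (fun y => s y ^+ 2 : R^o) y.
  move=> Uy; rewrite -deriveD//; first exact: Ck_on_derivable (sqC _ uC) Uy.
  exact: Ck_on_derivable (sqC _ sC) Uy.
have psi2 z : 'D_z (fun y => 'D_z psi y) x =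
    (2 * (u x * 'D_z (fun y => 'D_z u y) x) + 2 * ('D_z u x) ^+ 2) +
    (2 * (s x * 'D_z (fun y => 'D_z s y) x) + 2 * ('D_z s x) ^+ 2).
  have du := Ck_on_derivable (v := z) (Ck_on_derive z (sqC _ uC)) Ux.
  have ds := Ck_on_derivable (v := z) (Ck_on_derive z (sqC _ sC)) Ux.
  apply: etrans (congr2 +%R (derive2_sqr z oU uC Ux) (derive2_sqr z oU sC Ux)).
  apply: etrans (deriveD du ds).
  by apply: near_eq_derive; apply: (open_near oU Ux) => y; exact: psi1.
rewrite !psi2 psi1// !derive_sqr;
  [|exact: Ck_on_derivable sC Ux|exact: Ck_on_derivable uC Ux].
rewrite (cr x (drift v) Ux).1 (cr x (drift v) Ux).2.
exact: laplacian_sqr_algebra uu ss.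
Qed.

End CauchyRiemann.

Lemma four_squares_le0 (K : realFieldType) (a b c d : K) :
  2 * (a ^+ 2 + b ^+ 2 + c ^+ 2 + d ^+ 2) <= 0 -> a = 0 /\ b = 0.
Proof.
rewrite pmulr_rle0// => h.
have e : a ^+ 2 + b ^+ 2 + c ^+ 2 + d ^+ 2 = 0.
  by apply/eqP; rewrite eq_le h !addr_ge0 ?sqr_ge0.
move/eqP: e; rewrite !paddr_eq0 ?addr_ge0 ?sqr_ge0// !sqrf_eq0.
by move=> /andP[/andP[/andP[/eqP-> /eqP->]]].
Qed.

Lemma sum3_le0 (K : numDomainType) (N : nat) (a b c : 'I_N -> K) :
  \sum_i a i <= 0 -> \sum_i b i <= 0 -> \sum_i c i = 0 ->
  \sum_i (a i + b i + c i) <= 0.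
Proof.
by move=> a0 b0 c0; rewrite !big_split /= c0 addr0 -[leRHS](addr0 0) lerD.
Qed.

Lemma cauchy_riemann_max (R : realType) (m N : nat) (U : set 'rV[R]_m)
  (J : 'rV[R]_m -> 'M[R]_m) (x : 'rV[R]_m) (u s : 'I_N -> 'rV[R]_m -> R^o) :
  open U -> Ck_on 1 U J -> U x -> J x *m J x = - 1%:M ->
  (forall i, Ck_on 2 U (u i)) -> (forall i, Ck_on 2 U (s i)) ->
  (forall i, cauchy_riemann U J (u i) (s i)) ->
  (\forall y \near x,
     \sum_i (u i y ^+ 2 + s i y ^+ 2) <= \sum_i (u i x ^+ 2 + s i x ^+ 2)) ->
  forall i v, 'D_v (u i) x = 0 /\ 'D_v (s i) x = 0.
Proof.
move=> oU JC Ux JJ uC sC cr xmax i v.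
pose psi i y : R^o := u i y ^+ 2 + s i y ^+ 2.
pose Psi y : R^o := \sum_i psi i y.
have psiC j : Ck_on 2 U (psi j).
  by apply: Ck_on_add => //; exact: Ck_on_mul.
have PsiC : Ck_on 2 U Psi by exact: Ck_on_sum.
have D1 z y : U y -> 'D_z Psi y = \sum_j 'D_z (psi j) y.
  by move=> Uy; apply: derive_sumE => j; exact: Ck_on_derivable (psiC j) Uy.
have D2 z : 'D_z (fun y => 'D_z Psi y) x = \sum_j 'D_z (fun y => 'D_z (psi j) y) x.
  rewrite -derive_sumE; last first.
    by move=> j; exact: Ck_on_derivable (Ck_on_derive z (psiC j)) Ux.
  by apply: near_eq_derive; apply: (open_near oU Ux) => y; exact: D1.
set w := v *m J x.
have b0 := derive_local_max oU PsiC (drift J x v *m J x) Ux xmax.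
have v2 := derive2_local_max oU PsiC v Ux xmax.
have w2 := derive2_local_max oU PsiC w Ux xmax.
pose q j := 2 * ('D_v (u j) x ^+ 2 + 'D_v (s j) x ^+ 2 +
  'D_w (u j) x ^+ 2 + 'D_w (s j) x ^+ 2).
have q0 j : 0 <= q j by rewrite mulr_ge0// !addr_ge0// sqr_ge0.
have qsum : \sum_j q j <= 0.
  (* Summed over j, the two second-order terms are <= 0 and the drift term is 0 at the maximum,
     whereas the identity makes the total a sum of squares. *)
  rewrite (eq_bigr (fun j => 'D_v (fun y => 'D_v (psi j) y) x +
    'D_w (fun y => 'D_w (psi j) y) x +
    'D_(drift J x v *m J x) (psi j) x)); last first.
    move=> j _.
    exact: (esym (laplacian_sqr_norm oU JC Ux JJ v (uC j) (sC j) (cr j))).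
  apply: sum3_le0; [rewrite -(D2 v); exact: v2|rewrite -(D2 w); exact: w2|].
  exact: etrans (esym (D1 _ _ Ux)) b0.
have qi0 : q i <= 0.
  by apply: le_trans qsum; rewrite (bigD1 i)//= lerDl sumr_ge0.
exact: four_squares_le0 qi0.
Qed.

Lemma derive0_near_cst (R : realType) (V : normedModType R) (U : set V)
  (f : V -> R^o) (x : V) : open U -> Ck_on 1 U f -> U x ->
  (forall y v, U y -> 'D_v f y = 0) -> \forall y \near x, f y = f x.
Proof.
move=> oU fC Ux f0.
have /nbhs_ballP[d /= d0 dU] : nbhs x U by exact: open_nbhs_nbhs.
apply/nbhs_ballP; exists d => //= y xy.
have Ut (t : R) : 0 <= t <= 1 -> U (x + t *: (y - x)).
  move=> /andP[t0 t1]; apply: dU.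
  rewrite -ball_normE /= opprD addNKr normrN normrZ ger0_norm//.
  rewrite -ball_normE /= distrC in xy.
  by rewrite (le_lt_trans _ xy)// ler_piMl.
have [|t /andP[t0 t1] tE] := @MVT_line R V f x (y - x).
  by move=> t t01; exact: Ck_on_derivable fC (Ut t t01).
move: tE; rewrite subrKC f0; last by apply: Ut; rewrite !ltW.
by move/eqP; rewrite subr_eq0 => /eqP.
Qed.

(** * Complex-valued functions *)

Lemma complex_leibniz (K : rcfType) (a b c d a' b' c' d' : K) :
  Complex (a * c' + c * a' - (b * d' + d * b')) (a * d' + d * a' + (b * c' + c * b')) =
  Complex a' b' * Complex c d + Complex a b * Complex c' d' :> K[i].
Proof. by simpc; congr Complex; ring. Qed.

Section ComplexCalculus.
Context (R : realType) (V : normedModType R).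

Lemma csmooth_on_mul (U : set V) (f g : V -> R[i]) : open U ->
  csmooth_on U f -> csmooth_on U g -> csmooth_on U (fun x => f x * g x).
Proof.
move=> oU [fr fi] [gr gi]; split=> k.
  apply: (@Ck_on_ext R V R^o k U (fun x => complex.Re (f x) * complex.Re (g x) +
    - (complex.Im (f x) * complex.Im (g x)))) => //.
    by move=> x _; case: (f x) (g x) => a b [c d].
  apply: Ck_on_add => //; last apply: Ck_on_opp => //.
    exact: (Ck_on_mul oU (fr k) (gr k)).
  exact: (Ck_on_mul oU (fi k) (gi k)).
apply: (@Ck_on_ext R V R^o k U (fun x => complex.Re (f x) * complex.Im (g x) +
  complex.Im (f x) * complex.Re (g x))) => //.
  by move=> x _; case: (f x) (g x) => a b [c d].
apply: Ck_on_add => //.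
  exact: (Ck_on_mul oU (fr k) (gi k)).
exact: (Ck_on_mul oU (fi k) (gr k)).
Qed.

Lemma csmooth_on_inv (U : set V) (f : V -> R[i]) : open U ->
  (forall x, U x -> f x != 0) -> csmooth_on U f -> csmooth_on U (fun x => (f x)^-1).
Proof.
move=> oU f0 [fr fi].
(* The inverse is the conjugate of f divided by N = |f| ^ 2. *)
pose N x : R^o :=
  complex.Re (f x) * complex.Re (f x) + complex.Im (f x) * complex.Im (f x).
have N0 x : U x -> N x != 0.
  move=> /f0; rewrite /N eq_complex negb_and -!expr2; case: (f x) => a b /=.
  by rewrite paddr_eq0 ?sqr_ge0// !sqrf_eq0 negb_and.
have NC k : Ck_on k U N.
  exact: (Ck_on_add oU (Ck_on_mul oU (fr k) (fr k)) (Ck_on_mul oU (fi k) (fi k))).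
split=> k.
  apply: (@Ck_on_ext R V R^o k U (fun x => complex.Re (f x) * (N x)^-1)) => //.
    by move=> x _; rewrite /N; case: (f x) => a b /=; rewrite !expr2.
  exact: (Ck_on_mul oU (fr k) (Ck_on_inv oU N0 (NC k))).
apply: (@Ck_on_ext R V R^o k U (fun x => - (complex.Im (f x) * (N x)^-1))) => //.
  by move=> x _; rewrite /N; case: (f x) => a b /=; rewrite !expr2.
exact: (Ck_on_opp oU (Ck_on_mul oU (fi k) (Ck_on_inv oU N0 (NC k)))).
Qed.

Lemma csmooth_on_derivable (U : set V) (f : V -> R[i]) x v : csmooth_on U f -> U x ->
  derivable (fun y => complex.Re (f y) : R^o) x v /\
  derivable (fun y => complex.Im (f y) : R^o) x v.
Proof.
move=> [fr fi] Ux; split; first exact: Ck_on_derivable (fr 1%N) Ux.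
exact: Ck_on_derivable (fi 1%N) Ux.
Qed.

Lemma cderive_mul (U : set V) (f g : V -> R[i]) x v : open U ->
  csmooth_on U f -> csmooth_on U g -> U x ->
  cderive v (fun y => f y * g y) x = cderive v f x * g x + f x * cderive v g x.
Proof.
move=> oU fC gC Ux.
have [dfr dfi] := csmooth_on_derivable v fC Ux.
have [dgr dgi] := csmooth_on_derivable v gC Ux.
rewrite /cderive.
pose fr y : R^o := complex.Re (f y); pose fi y : R^o := complex.Im (f y).
pose gr y : R^o := complex.Re (g y); pose gi y : R^o := complex.Im (g y).
have -> : (fun y => complex.Re (f y * g y) : R^o) = fr * gr - fi * gi.
  by apply/funext => y; rewrite /fr /fi /gr /gi !fctE; case: (f y) (g y) => a b [c d].
have -> : (fun y => complex.Im (f y * g y) : R^o) = fr * gi + fi * gr.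
  by apply/funext => y; rewrite /fr /fi /gr /gi !fctE; case: (f y) (g y) => a b [c d].
rewrite (deriveB (derivableM dfr dgr) (derivableM dfi dgi)).
rewrite (deriveD (derivableM dfr dgi) (derivableM dfi dgr)).
rewrite (deriveM dfr dgr) (deriveM dfi dgi) (deriveM dfr dgi) (deriveM dfi dgr).
rewrite -/fr -/fi -/gr -/gi.
case: (f x) (g x) => a b [c d] /=.
move: ('D_v fr x) ('D_v fi x) ('D_v gr x) ('D_v gi x) => a' b' c' d'.
exact: complex_leibniz.
Qed.

End ComplexCalculus.

Lemma cderive_linear (R : realType) (m : nat) (U : set 'rV[R]_m)
  (f : 'rV[R]_m -> R[i]) x (b c : R) u v : open U -> csmooth_on U f -> U x ->
  cderive (b *: u + c *: v) f x = b%:C%C * cderive u f x + c%:C%C * cderive v f x.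
Proof.
move=> oU [fr fi] Ux; rewrite /cderive.
have lin h : Ck_on 1 U h -> 'D_(b *: u + c *: v) h x = b * 'D_u h x + c * 'D_v h x.
  move=> hC; have L := C1_derive_linear oU hC Ux.
  rewrite L; congr (_ + _).
  have [_ ->] := is_deriveZv c (derivableP (Ck_on_derivable (v := v) hC Ux)).
  by [].
rewrite (lin _ (fr 1%N)) (lin _ (fi 1%N)).
move: ('D_u _ x) ('D_v _ x) => p q; move: ('D_u _ x) ('D_v _ x) => r s.
by simpc.
Qed.

(** * Closed multiples of sigma *)

Lemma multilinear_rowsZ (R : realType) (n m : nat) (w : 'M[R]_(n, m) -> R[i])
  (k : R[i]) :
  multilinear_rows w -> multilinear_rows (fun A => k * w A).
Proof.
move=> wm A B C i b c rA rB rC; rewrite (wm A B C i b c)//.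
by rewrite mulrDr !mulrA ![k * _]mulrC.
Qed.

Lemma alternating_rowsZ (R : realType) (n m : nat) (w : 'M[R]_(n, m) -> R[i])
  (k : R[i]) :
  alternating_rows w -> alternating_rows (fun A => k * w A).
Proof. by move=> wa A i j ij rA; rewrite (wa A i j)// mulr0. Qed.

(** Left translation by q p^-1 carries the point p where [sigma] is nonzero to any prescribed point
    q, and invariance carries the nonzero value along. *)
Lemma left_invariant_neq0 (R : realType) (m k : nat) (G : lieGroupType R m)
  (sigma : cform_family k G) : left_invariant_form sigma -> nonzero_form sigma ->
  forall d y, ccod (chart d) y -> exists A, sigma d y A != 0.
Proof.
move=> sL [c [x [A [cx sA]]]] d y dy.
pose p := cinv (chart c) x; pose q := cinv (chart d) y.
pose g : G := (q * p^-1)%g.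
have gp : (g * p)%g = q by rewrite /g mulgVK.
have dom : ldom (fun p : G => (g * p)%g) c d x.
  by split => //; rewrite -/p gp; exact: cinv_dom.
have := sL g c d x dom A.
rewrite {1}/lrep -/p gp cinvK// => sE.
by move: sA; rewrite -sE => sA; eexists; exact: sA.
Qed.

Section Closed.
Context (R : realType) (n : nat) (M : smoothManifoldType R n.*2).
Context (J : endo_field M) (sigma : cform_family n M).
Hypotheses (sigma_form : is_cform sigma) (sigmaJ : bidegree_k0 J sigma).
Hypothesis sigma0 : forall c x, ccod (chart c) x -> exists A, sigma c x A != 0.

Lemma smooth_cfun_div (f1 f2 : M -> R[i]) : smooth_cfun f1 -> (forall p, f1 p != 0) ->
  smooth_cfun f2 -> smooth_cfun (fun p => f2 p / f1 p).
Proof.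
move=> f1C f10 f2C c; apply: csmooth_on_mul; first exact: ccod_open.
  exact: f2C.
apply: csmooth_on_inv; [exact: ccod_open|by move=> x _; exact: f10|exact: f1C].
Qed.

Lemma ext_derivative_scale (f1 f2 : M -> R[i]) c x A :
  smooth_cfun f1 -> (forall p, f1 p != 0) -> smooth_cfun f2 ->
  closed_form (scale_form f1 sigma) -> ccod (chart c) x ->
  ext_derivative (scale_form f2 sigma) c x A =
  wedge1 (fun v => cderive v ((fun p => f2 p / f1 p) \o cinv (chart c)) x)
    (scale_form f1 sigma c x) A.
Proof.
move=> f1C f10 f2C cl cx.
have qC := smooth_cfun_div f1C f10 f2C.
pose q p := f2 p / f1 p.
have oU : open (ccod (chart c)) by exact: ccod_open.
have sC B : csmooth_on (ccod (chart c)) (fun y => scale_form f1 sigma c y B).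
  exact: (csmooth_on_mul oU (f1C c) (cform_smooth sigma_form c B)).
(* Leibniz rule for f2 sigma = q (f1 sigma); the term q d(f1 sigma) vanishes since f1 sigma is
   closed. *)
transitivity (wedge1 (fun v => cderive v (q \o cinv (chart c)) x)
    (scale_form f1 sigma c x) A +
    q (cinv (chart c) x) * ext_derivative (scale_form f1 sigma) c x A); last first.
  by rewrite cl// mulr0 addr0.
rewrite /ext_derivative /wedge1 mulr_sumr -big_split; apply: eq_bigr => i _ /=.
have -> : (fun y => scale_form f2 sigma c y (row' i A)) =
  (fun y => (q \o cinv (chart c)) y * scale_form f1 sigma c y (row' i A)).
  by apply/funext => y; rewrite /scale_form /q /= mulrA divfK.
rewrite (cderive_mul _ oU (qC c) (sC (row' i A)) cx) mulrDr; congr (_ + _).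
by rewrite mulrCA.
Qed.

Lemma closed_scale_holomorphic (f1 f2 : M -> R[i]) :
  smooth_cfun f1 -> (forall p, f1 p != 0) -> smooth_cfun f2 ->
  closed_form (scale_form f1 sigma) ->
  closed_form (scale_form f2 sigma) <-> holomorphic_fun J (fun p => f2 p / f1 p).
Proof.
move=> f1C f10 f2C cl.
have qC := smooth_cfun_div f1C f10 f2C.
have wm c x : ccod (chart c) x -> multilinear_rows (scale_form f1 sigma c x).
  by move=> cx; apply: multilinear_rowsZ; exact: (cform_multilinear sigma_form cx).
have wa c x : ccod (chart c) x -> alternating_rows (scale_form f1 sigma c x).
  by move=> cx; apply: alternating_rowsZ; exact: (cform_alternating sigma_form cx).
have wJ c x : ccod (chart c) x -> forall (i : 'I_n) (A B : 'M[R]_(n, n.*2)),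
    row i B = row i A *m J c x -> row' i B = row' i A ->
    scale_form f1 sigma c x A + 'i%C * scale_form f1 sigma c x B = 0.
  move=> cx i A B rB r'B; rewrite /scale_form mulrCA -mulrDr.
  by rewrite (sigmaJ cx rB r'B) mulr0.
split=> [cl2|[_ hol]].
  split=> // c x cx v.
  have [E sE] := sigma0 cx.
  have fE : scale_form f1 sigma c x E != 0 by rewrite mulf_neq0.
  apply: (wedge1_eq0_Jlinear (wJ c x cx)
    (a := fun v => cderive v ((fun p => f2 p / f1 p) \o cinv (chart c)) x) fE) => A.
  by rewrite -ext_derivative_scale//; exact: cl2.
move=> c x cx A; rewrite (ext_derivative_scale _ f1C f10 f2C cl cx).
apply: (Jlinear_wedge1_eq0 (wm c x cx) (wa c x cx) (wJ c x cx)).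
- by rewrite doubleS ltnS leqnSn.
- have oU : open (ccod (chart c)) by exact: ccod_open.
  move=> b e u v; exact: (cderive_linear _ _ _ _ oU (qC c) cx).
- exact: hol.
Qed.

End Closed.

(** * Holomorphic functions on compact groups *)

Section HolomorphicLocal.
Context (R : realType) (m : nat) (M : smoothManifoldType R m) (J : endo_field M).
Context (q : M -> R[i]).
Hypothesis q_holo : holomorphic_fun J q.

Lemma ldom_open (L : M -> M) (c d : chart_ix M) : continuous L -> open (ldom L c d).
Proof.
move=> cL; rewrite openE => x [cx dLx]; apply: filterI.
  by apply: open_nbhs_nbhs; split => //; exact: ccod_open.
have cLx : {for x, continuous (L \o cinv (chart c))}.
  by apply: continuous_comp; [exact: cinv_continuous|exact: cL].
apply: (cLx (cdom (chart d))); apply: open_nbhs_nbhs; split => //.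
exact: cdom_open.
Qed.

(** The map [L] will be a left translation; [L = id] gives q itself in the chart. *)
Definition qRe (L : M -> M) c : 'rV[R]_m -> R^o :=
  fun x => complex.Re (q (L (cinv (chart c) x))).
Definition qIm (L : M -> M) c : 'rV[R]_m -> R^o :=
  fun x => complex.Im (q (L (cinv (chart c) x))).

Lemma qRe_lrep (L : M -> M) c d x : ldom L c d x ->
  qRe id d (lrep L c d x) = qRe L c x /\ qIm id d (lrep L c d x) = qIm L c x.
Proof. by move=> [_ dx]; rewrite /qRe /qIm /lrep cfunK. Qed.

Lemma q_smooth d k : Ck_on k (ccod (chart d)) (qRe id d) /\
  Ck_on k (ccod (chart d)) (qIm id d).
Proof. by have [/(_ d)[qr qi] _] := q_holo; split; [exact: qr|exact: qi]. Qed.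

Lemma q_cauchy_riemann d : cauchy_riemann (ccod (chart d)) (J d) (qRe id d) (qIm id d).
Proof.
move=> y v dy; have [_ /(_ d y dy v)] := q_holo.
rewrite /cderive -/(qRe id d) -/(qIm id d).
move: ('D_(v *m J d y) _ y) ('D_(v *m J d y) _ y) ('D_v _ y) ('D_v _ y) => a b a' b'.
by simpc => -[-> ->].
Qed.

Lemma lrep_is_derive (L : M -> M) c d x v : smooth_map L -> ldom L c d x ->
  is_derive x v (lrep L c d) ('D_v (lrep L c d) x).
Proof.
move=> [_ /(_ c d) LC] dx; apply: derivableP.
exact: Ck_on_derivable (LC 1%N) dx.
Qed.

Lemma lrep_ccod (L : M -> M) c d x : ldom L c d x -> ccod (chart d) (lrep L c d x).
Proof. by move=> [_ dx]; exact: cfun_cod. Qed.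

(** Near x a single target chart [d] suffices. There q o L is q read in [d] composed with
    [lrep L c d], so smoothness comes from composition and Cauchy-Riemann from the chain rule. *)
Lemma holomorphic_comp_local (L : M -> M) c x : holomorphic_map J J L ->
  ccod (chart c) x ->
  exists U : set 'rV[R]_m, [/\ open U, U x, Ck_on 2 U (qRe L c), Ck_on 2 U (qIm L c) &
    cauchy_riemann U (J c) (qRe L c) (qIm L c)].
Proof.
move=> [Ls Lh] cx; have [d dLx] := chart_cover (L (cinv (chart c) x)).
have [Lc LC] := Ls.
have oU : open (ldom L c d) by exact: ldom_open.
have oC : open (ccod (chart d)) by exact: ccod_open.
have extRe y : ldom L c d y -> (qRe id d \o lrep L c d) y = qRe L c y.
  by move=> dy; exact: (qRe_lrep dy).1.
have extIm y : ldom L c d y -> (qIm id d \o lrep L c d) y = qIm L c y.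
  by move=> dy; exact: (qRe_lrep dy).2.
have [rC iC] := q_smooth d 2.
exists (ldom L c d); split => //.
- apply: (Ck_on_ext oU extRe).
  by apply: (Ck_on_comp oU oC _ (LC c d 2%N) rC); exact: lrep_ccod.
- apply: (Ck_on_ext oU extIm).
  by apply: (Ck_on_comp oU oC _ (LC c d 2%N) iC); exact: lrep_ccod.
have chain v y : ldom L c d y ->
    'D_v (qRe L c) y = 'D_('D_v (lrep L c d) y) (qRe id d) (lrep L c d y) /\
    'D_v (qIm L c) y = 'D_('D_v (lrep L c d) y) (qIm id d) (lrep L c d y).
  move=> dy; have lD := lrep_is_derive v Ls dy; have ly := lrep_ccod dy.
  split.
    have [_ <-] := C1_chain oC (Ck_onW rC) ly lD.
    apply: near_eq_derive; apply: (open_near oU dy) => z dz; exact: esym (extRe z dz).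
  have [_ <-] := C1_chain oC (Ck_onW iC) ly lD.
  apply: near_eq_derive; apply: (open_near oU dy) => z dz; exact: esym (extIm z dz).
move=> y v dy.
have [-> ->] := chain (v *m J c y) y dy; have [-> ->] := chain v y dy.
(* Since dL commutes with J, this is Cauchy-Riemann for q in the direction dL(v). *)
rewrite Lh//.
have [h1 h2] := q_cauchy_riemann ('D_v (lrep L c d) y) (lrep_ccod dy).
by split.
Qed.

(* The chain rule for q = (q \o L) \o L', L' being the inverse of L. *)
Lemma derive_pullback0 (L L' : M -> M) c d x w : smooth_map L' ->
  (forall p, L (L' p) = p) -> (forall p, L' (L p) = p) ->
  ccod (chart c) x -> cdom (chart d) (L (cinv (chart c) x)) ->
  (exists U, [/\ open U, U x, Ck_on 2 U (qRe L c) & Ck_on 2 U (qIm L c)]) ->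
  (forall v, 'D_v (qRe L c) x = 0 /\ 'D_v (qIm L c) x = 0) ->
  cderive w (q \o cinv (chart d)) (chart d (L (cinv (chart c) x))) = 0.
Proof.
move=> L's LL' L'L cx dLx [U [oU Ux rC iC]] D0.
set y := chart d _; set p := cinv (chart c) x.
have dy : ldom L' d c y.
  split; first exact: cfun_cod.
  by rewrite /y cfunK// L'L; exact: cinv_dom.
have ly : lrep L' d c y = x by rewrite /lrep /y cfunK// L'L cinvK.
have oD : open (ldom L' d c) by apply: ldom_open; case: L's.
have lD := lrep_is_derive w L's dy.
have Uy : U (lrep L' d c y) by rewrite ly.
have ext z : ldom L' d c z -> qRe L c (lrep L' d c z) = qRe id d z /\
    qIm L c (lrep L' d c z) = qIm id d z.
  by move=> [_ dz]; rewrite /qRe /qIm /lrep cfunK// LL'.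
rewrite /cderive -/(qRe id d) -/(qIm id d).
have -> : 'D_w (qRe id d) y = 0.
  have [_ e] := C1_chain oU (Ck_onW rC) Uy lD.
  rewrite ly (D0 _).1 in e; rewrite -[RHS]e.
  by apply: near_eq_derive; apply: (open_near oD dy) => z dz; rewrite /= (ext z dz).1.
have -> : 'D_w (qIm id d) y = 0.
  have [_ e] := C1_chain oU (Ck_onW iC) Uy lD.
  rewrite ly (D0 _).2 in e; rewrite -[RHS]e.
  by apply: near_eq_derive; apply: (open_near oD dy) => z dz; rewrite /= (ext z dz).2.
by [].
Qed.

Lemma q_continuous : continuous (fun p => complex.Re (q p) : R^o) /\
  continuous (fun p => complex.Im (q p) : R^o).
Proof.
suff H (F : R[i] -> R) :
    (forall d, Ck_on 0 (ccod (chart d)) (fun x => F (q (cinv (chart d) x)) : R^o)) ->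
    continuous (fun p => F (q p) : R^o).
  by split; apply: H => d; [exact: (q_smooth d 0).1|exact: (q_smooth d 0).2].
move=> FC p; have [d dp] := chart_cover p.
have cd : {for p, continuous (fun p => F (q (cinv (chart d) (chart d p))) : R^o)}.
  apply: (@continuous_comp _ _ R^o (chart d) (fun x => F (q (cinv (chart d) x)))).
    exact: cfun_continuous.
  exact: Ck_on_continuous (FC d) (cfun_cod dp).
move: cd; rewrite /prop_for /continuous_at cfunK// => h.
apply: cvg_trans h; apply: near_eq_cvg.
apply: (@open_near _ (cdom (chart d))) => //; first exact: cdom_open.
by move=> y dy; rewrite cfunK.
Qed.

End HolomorphicLocal.

Lemma open_forall_ord (T : topologicalType) (N : nat) (U : 'I_N -> set T) :
  (forall i, open (U i)) -> open [set x | forall i, U i x].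
Proof.
move=> oU; rewrite openE => x Ux; apply: filter_forall => i.
by apply: open_nbhs_nbhs; split.
Qed.

Lemma sum_ord_continuous (R : realType) (T : topologicalType) (N : nat)
  (F : 'I_N -> T -> R^o) : (forall i, continuous (F i)) ->
  continuous (fun x => \sum_i F i x : R^o).
Proof.
move=> Fc; apply: (@continuous_big R^o 'I_N +%R 0 xpredT) => //.
by move=> x; apply: cvgD; [exact: cvg_fst|exact: cvg_snd].
Qed.

(** The chart and the vector are fixed, so this is the nonvanishing set of a continuous function of
    p. *)
Lemma noncritical_open (R : realType) (m : nat) (M : smoothManifoldType R m)
  (q : M -> R[i]) (d : chart_ix M) (w : 'rV[R]_m) : smooth_cfun q ->
  open [set p | cdom (chart d) p /\ cderive w (q \o cinv (chart d)) (chart d p) != 0].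
Proof.
move=> /(_ d)[qr qi]; rewrite openE => p [dp qp].
have cv (f : 'rV[R]_m -> R^o) : (forall k, Ck_on k (ccod (chart d)) f) ->
    {for p, continuous (fun p => 'D_w f (chart d p))}.
  move=> fC; apply: (@continuous_comp _ _ R^o (chart d) (fun x => 'D_w f x)).
    exact: cfun_continuous.
  exact: Ck_on_continuous (Ck_on_derive w (fC 1%N)) (cfun_cod dp).
have o0 : open [set x : R^o | x != 0] by exact: open_neq.
have cr := cv _ qr; have ci := cv _ qi.
have : nbhs p (cdom (chart d)) by apply: open_nbhs_nbhs; split => //; exact: cdom_open.
move: qp; rewrite eq_complex negb_and => /orP[] /= h nd.
  have := cr [set x | x != 0] (open_nbhs_nbhs (conj o0 h)).
  move=> h'; apply: filterS2 nd h' => z dz hz; split=> //.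
  by rewrite eq_complex negb_and hz.
have := ci [set x | x != 0] (open_nbhs_nbhs (conj o0 h)).
move=> h'; apply: filterS2 nd h' => z dz hz; split=> //.
by rewrite eq_complex negb_and hz orbT.
Qed.

Section CompactGroup.
Context (R : realType) (m : nat) (G : lieGroupType R m) (J : endo_field G).
Context (q : G -> R[i]).
Hypothesis J_inv : left_invariant_cs J.
Hypothesis q_holo : holomorphic_fun J q.

(** The preimages of [W] under left translations cover G, as p0 p^-1 sends p to the point p0 of [W];
    compactness extracts finitely many. *)
Lemma finite_translates (W : set G) : compact [set: G] -> open W -> W !=set0 ->
  exists (N : nat) (a : 'I_N -> G), forall p, exists i, W (a i * p)%g.
Proof.
move=> cG oW [p0 Wp0].
(* [compact_cover] is only available for pointed topological spaces *)
pose pG : ptopologicalType :=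
  HB.pack (G : topologicalType) (isPointed.Build (G : topologicalType) 1%g).
have {}cG : cover_compact [set: pG] by rewrite -compact_cover.
have [||D _ cov] := cG G setT (fun a : G => (fun p : G => (a * p)%g) @^-1` W).
- move=> a _; apply: open_comp oW => p _.
  by have [_ /(_ a)[[ac _] _]] := J_inv; exact: ac.
- by move=> p _; exists (p0 * p^-1)%g => //; rewrite /preimage /= mulgVK.
pose s := finmap.enum_fset D.
exists (size s), (tnth (in_tuple s)) => p.
have [a Da Wap] := cov p I.
have sD : (index a s < size s)%N by rewrite index_mem.
exists (Ordinal sD); by rewrite (tnth_nth a) /= nth_index.
Qed.

Lemma compact_holomorphic_derive0 : compact [set: G] ->
  forall d y w, ccod (chart d) y -> cderive w (q \o cinv (chart d)) y = 0.
Proof.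
move=> cG d y w dy; apply/eqP/negPn/negP => qy0.
have [Jcs JL] := J_inv.
pose W := [set p | cdom (chart d) p /\
  cderive w (q \o cinv (chart d)) (chart d p) != 0].
have oW : open W by apply: noncritical_open; case: q_holo.
have W0 : W !=set0.
  by exists (cinv (chart d) y); split; [exact: cinv_dom|rewrite cinvK].
have [N [a aW]] := finite_translates cG oW W0.
pose L i : G -> G := fun p => (a i * p)%g.
pose Psi (p : G) : R :=
  \sum_i (complex.Re (q (L i p)) ^+ 2 + complex.Im (q (L i p)) ^+ 2).
have Psi_cont : continuous Psi.
  apply: (@sum_ord_continuous R G N (fun i p =>
    complex.Re (q (L i p)) ^+ 2 + complex.Im (q (L i p)) ^+ 2)) => i p.
  have [rc ic] := q_continuous q_holo.
  have Lp : {for p, continuous (L i)} by have [[Lc _] _] := JL (a i); exact: Lc.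
  have r := continuous_comp Lp (rc (L i p)).
  have s := continuous_comp Lp (ic (L i p)).
  by apply: cvgD; rewrite expr2; apply: cvgM.
have [p0 _ p0max] : exists2 c, c \in [set: G] &
    forall t, t \in [set: G] -> Psi t <= Psi c.
  apply: compact_EVT_max => //; first by exists (cinv (chart d) y).
  by apply: continuous_subspaceT.
have [c cp0] := chart_cover p0.
pose x := chart c p0.
have cx : ccod (chart c) x by exact: cfun_cod.
have px : cinv (chart c) x = p0 by exact: cfunK.
have loc i := holomorphic_comp_local q_holo (JL (a i)) cx.
pose V i := projT1 (cid (loc i)).
have VP i : [/\ open (V i), V i x, Ck_on 2 (V i) (qRe q (L i) c),
    Ck_on 2 (V i) (qIm q (L i) c) &
    cauchy_riemann (V i) (J c) (qRe q (L i) c) (qIm q (L i) c)].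
  exact: projT2 (cid (loc i)).
(* A common neighbourhood for all the translates, open because there are finitely many of them. *)
pose U := ccod (chart c) `&` [set z | forall i, V i z].
have oU : open U.
  apply: openI; first exact: ccod_open.
  by apply: open_forall_ord => i; case: (VP i).
have UV i : U `<=` V i by move=> z [_]; exact.
have Ux : U x by split => // i; case: (VP i).
have D0 : forall i v, 'D_v (qRe q (L i) c) x = 0 /\ 'D_v (qIm q (L i) c) x = 0.
  apply: (@cauchy_riemann_max R m N U (J c) x) => //.
  - by apply: Ck_on_sub (cs_smooth Jcs c 1%N) => z [].
  - exact: (cs_square Jcs cx).
  - by move=> i; have [_ _ h _ _] := VP i; exact: Ck_on_sub (UV i) h.
  - by move=> i; have [_ _ _ h _] := VP i; exact: Ck_on_sub (UV i) h.
  - by move=> i z v /(UV i); have [_ _ _ _] := VP i; exact.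
  - apply: filterE => z.
    have := p0max (cinv (chart c) z) (mem_set I).
    by rewrite /Psi -px.
(* One translation sends the maximum point p0 into [W]; the vanishing differential of q o L_i at p0
   then forces dq = 0 at that image, contradicting the choice of [W]. *)
have [i [dai /eqP]] := aW p0; apply.
have := @derive_pullback0 R m G q (L i) (fun p => ((a i)^-1 * p)%g) c d x w.
rewrite px; apply => //.
- by have [] := JL (a i)^-1%g.
- by move=> p; rewrite /L mulgA mulgV mul1g.
- by move=> p; rewrite /L mulgA mulVg mul1g.
- by have [oV Vx h1 h2 _] := VP i; exists (V i).
Qed.

(** With zero derivatives every level set of q is open. The complement of one is a union of others,
    hence open too, and connectedness concludes. *)
Lemma compact_holomorphic_cst : compact [set: G] -> connected [set: G] ->
  forall p, q p = q 1%g.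
Proof.
move=> cG coG.
have D0 := compact_holomorphic_derive0 cG.
have loc z : open [set p | q p = z].
  rewrite openE => p qp; have [c cp] := chart_cover p.
  have [rC iC] := q_smooth q_holo c 1.
  have oC : open (ccod (chart c)) by exact: ccod_open.
  have cx := cfun_cod cp.
  have D0' y v : ccod (chart c) y -> 'D_v (qRe q id c) y = 0 /\ 'D_v (qIm q id c) y = 0.
    by move=> cy; have [] := D0 c y v cy.
  have nr := derive0_near_cst oC rC cx (fun y v cy => (D0' y v cy).1).
  have ni := derive0_near_cst oC iC cx (fun y v cy => (D0' y v cy).2).
  have nc : nbhs p (cdom (chart c)).
    by apply: open_nbhs_nbhs; split => //; exact: cdom_open.
  have n2 : \forall y \near p,
      qRe q id c (chart c y) = qRe q id c (chart c p) /\
      qIm q id c (chart c y) = qIm q id c (chart c p).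
    exact: (cfun_continuous cp (filterI nr ni)).
  apply: filterS (filterI nc n2) => y [cy [hr hi]].
  move: hr hi; rewrite /qRe /qIm /= !cfunK// => hr hi.
  by rewrite /= -qp; apply/eqP; rewrite eq_complex hr hi !eqxx.
have /seteqP[_ H] : [set p | q p = q 1%g] = [set: G].
  apply: coG.
  - by exists 1%g.
  - by exists [set p | q p = q 1%g]; [exact: loc|rewrite setTI].
  - exists [set p | q p = q 1%g]; last by rewrite setTI.
    rewrite -openC.
    rewrite (_ : ~` _ = \bigcup_(z in [set z | z != q 1%g]) [set p | q p = z]).
      by apply: bigcup_open => z _; exact: loc.
    apply/seteqP; split => [p /= /eqP qp|p [z /= z1 qz]]; first by exists (q p).
    by rewrite /= qz; exact/eqP.
by move=> p; exact: H.
Qed.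

End CompactGroup.

Theorem lemma4p1 (R : realType) (n : nat) (G : lieGroupType R n.*2)
  (J : endo_field G) (sigma : cform_family n G) (f1 f2 : G -> R[i]) :
  connected [set: G] ->
  left_invariant_cs J ->
  is_cform sigma -> bidegree_k0 J sigma ->
  left_invariant_form sigma -> nonzero_form sigma ->
  smooth_cfun f1 -> (forall p, f1 p != 0) ->
  closed_form (scale_form f1 sigma) ->
  smooth_cfun f2 -> (forall p, f2 p != 0) ->
  (closed_form (scale_form f2 sigma) <->
     holomorphic_fun J (fun p => f2 p / f1 p)) /\
  (compact [set: G] -> closed_form (scale_form f2 sigma) ->
     exists2 c : R[i], c != 0 & forall p, f2 p = c * f1 p).
Proof.
move=> coG J_inv sF sJ sL s0 f1C f10 cl1 f2C f20.
have iffH := closed_scale_holomorphic sF sJ (left_invariant_neq0 sL s0) f1C f10 f2C cl1.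
split=> // cG /iffH q_holo.
(* The constant is the value of the quotient at the identity, nonzero because [f2] has no zeros. *)
exists (f2 1%g / f1 1%g); first by rewrite mulf_neq0// invr_eq0.
by move=> p; rewrite -(compact_holomorphic_cst J_inv q_holo cG coG p) divfK.
Qed.
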